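(* Let $\alpha\in(0,1)$. For every $s>0$, there exists a constant $c_{\alpha,s}>0$ such that $V_\alpha^s-c_{\alpha,s}$ is a mixture of exponentials (ME).
   Context: For $\alpha\in(0,1)$ put $\beta=1-\alpha$ and $$b_\alpha(u)=\Big(\frac{\sin u}{\sin(\alpha u)}\Big)^{\alpha}\Big(\frac{\sin u}{\sin(\beta u)}\Big)^{\beta},\qquad u\in(0,\pi).$$ Let $U$ be uniformly distributed on $(0,\pi)$ and set $V_\alpha=b_\alpha(U)^{-1/\beta}$. A random variable $X$ is a mixture of exponentials (ME) if there is a positive random variable $R$ such that $X$ has the same law as $L\times R$, where $L$ is a standard exponential random variable independent of $R$. *)

(* Defs.v *)
From HB Require Import structures.
From mathcomp Require Import all_boot all_order all_algebra.
From mathcomp Require Import all_classical all_reals all_analysis.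
From mathcomp Require Import measurable_realfun.
Set Implicit Arguments.
Unset Strict Implicit.
Unset Printing Implicit Defensive.
Import Order.TTheory GRing.Theory Num.Theory.
Import numFieldNormedType.Exports.
Local Open Scope classical_set_scope.
Local Open Scope ring_scope.

(* Laws are compared on measurable sets only: the value of a measure on a
   non-measurable set is meaningless, so Leibniz equality of the underlying
   set functions would be too strong. *)
Definition has_law d (T : measurableType d) (R : realType)
    (P : probability T R) (X : {RV P >-> R}) (mu : set R -> \bar R) : Prop :=
  forall A : set R, measurable A -> distribution P X A = mu A.

Definition independent_RV d (T : measurableType d) (R : realType)
    (P : probability T R) (X Y : {RV P >-> R}) : Prop :=
  forall A B : set R, measurable A -> measurable B ->
    P ((X @^-1` A) `&` (Y @^-1` B)) = (P (X @^-1` A) * P (Y @^-1` B))%E.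

(* Being a mixture of exponentials is a property of the law of X only, so the
   factors L and M may live on another probability space. *)
Definition mixture_of_exponentials d (T : measurableType d) (R : realType)
    (P : probability T R) (X : {RV P >-> R}) : Prop :=
  exists (d' : measure_display) (T' : measurableType d')
         (Q : probability T' R) (L M : {RV Q >-> R}),
    [/\ has_law L (exponential_prob 1),
        forall w : T', 0 < M w,
        independent_RV L M &
        has_law X (distribution Q (L \* M : {RV Q >-> R}))].

Definition b_fun (R : realType) (alpha u : R) : R :=
  let beta := 1 - alpha in
  (sin u / sin (alpha * u)) `^ alpha * (sin u / sin (beta * u)) `^ beta.

Lemma measurable_b_fun (R : realType) (alpha : R) :
  measurable_fun [set: R] (b_fun alpha).
Proof.
have msin : measurable_fun [set: R] (@sin R).
  by apply: continuous_measurable_fun; exact: continuous_sin.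
have minv : measurable_fun [set: R] (@GRing.inv R).
  rewrite (_ : GRing.inv = (fun x : R => x * (x * x) `^ (-1))); last first.
    apply/funext => x; rewrite powR_inv1 -?expr2 ?sqr_ge0//.
    have [->|x0] := eqVneq x 0; first by rewrite invr0 mul0r.
    by rewrite expr2 invfM mulrA divff// mul1r.
  apply: measurable_funM => //.
  apply: (measurableT_comp (measurable_powR (-1))).
  exact: measurable_funM.
have mq (c : R) : measurable_fun [set: R] (fun u => sin u / sin (c * u)).
  apply: measurable_funM => //.
  apply: (measurableT_comp minv); apply: (measurableT_comp msin).
  exact: measurable_funM.
by apply: measurable_funM;
  [exact: (measurableT_comp (measurable_powR _) (mq _))
  |exact: (measurableT_comp (measurable_powR _) (mq _))].
Qed.

HB.instance Definition _ (R : realType) (alpha : R) :=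
  isMeasurableFun.Build _ _ _ _ (b_fun alpha) (measurable_b_fun alpha).

Section powRV.
Context d (T : measurableType d) (R : realType) (P : probability T R).
Variables (X : {RV P >-> R}) (a : R).

Definition powRV_fun (w : T) : R := X w `^ a.

Let measurable_powRV_fun : measurable_fun [set: T] powRV_fun.
Proof. exact: measurableT_comp (measurable_powR _) _. Qed.

HB.instance Definition _ :=
  isMeasurableFun.Build _ _ _ _ powRV_fun measurable_powRV_fun.

Definition powRV : {RV P >-> R} := powRV_fun.
End powRV.

Definition V_RV d (T : measurableType d) (R : realType) (P : probability T R)
    (alpha : R) (U : {RV P >-> R}) : {RV P >-> R} :=
  powRV (b_fun alpha \o U : {RV P >-> R}) (- (1 - alpha)^-1).

(* Main.v *)
(* The coordinate [1 / b_alpha(u)] is the value of [w^alpha (1-w)^beta] at the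
   complex point [w] such that [arg w = beta u] and [arg (1-w) = - alpha u].
   Inverting this at infinity, [1 - 1/w] is [B z] for [z = b e^(- i pi beta)]
   and [B] the power series solution of [B = 1 - z B^beta], so that, up to
   conjugation, the angle is
   [pi - u = sum_(n >= 1) c_n b^n] with
     [c_n = (-1)^(n-1) binomial(beta n - 1, n - 1) sin(pi beta n) / n >= 0]
   (Lagrange inversion), for [0 <= b < b_0 = alpha^(-alpha) beta^(-beta)].
   Hence [P(b_alpha(U) < b) = sum_n c_n b^n / pi], and with
   [c = b_0^(-s/beta)] the tail of [V^s - c] is the mixture
     [P(V^s - c > x) = sum_n w_n (1 + x/c)^(- n beta/s)], [w_n = c_n b_0^n / pi],
   of Pareto tails, each of which is a mixture of exponentials with Gamma
   distributed rate. *)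
Require Import Defs.
From HB Require Import structures.
From mathcomp Require Import all_boot all_order all_algebra.
From mathcomp Require Import all_classical all_reals all_analysis.
From mathcomp Require Import measurable_realfun.
From mathcomp Require Import zify ring lra.
Set Implicit Arguments.
Unset Strict Implicit.
Unset Printing Implicit Defensive.
Import Order.TTheory GRing.Theory Num.Theory.
Import numFieldNormedType.Exports.
Local Open Scope classical_set_scope.
Local Open Scope ring_scope.

(** * Coefficients of the Lagrange inversion *)

(** No complex function appears in the code: [B] enters only through the explicit coefficients of
    its powers, and the equation [B = 1 - z B^beta] on the ray is recovered from a linear
    differential equation in the real variable [b]. The series has to represent the angle for every
    [u], so its radius of convergence must be seen to reach [b_0] itself, and every angle of []0,
    pi[] must be shown to be attained. The exponent [s] only rescales the Pareto exponents, which is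
    why any [s > 0] is allowed; [c] is the infimum of [V^s], approached as [u] tends to 0. *)

Section polynomial_functions.
Context {R : numFieldType}.
Implicit Types f g : R -> R.

Definition polyfun f := exists p : {poly R}, forall x, f x = p.[x].

Lemma polyfun_cst c : polyfun (fun=> c).
Proof. by exists c%:P => x; rewrite hornerC. Qed.

Lemma polyfun_id : polyfun id.
Proof. by exists 'X => x; rewrite hornerX. Qed.

Lemma polyfunD f g : polyfun f -> polyfun g -> polyfun (fun x => f x + g x).
Proof. by move=> [p fp] [q gq]; exists (p + q) => x; rewrite hornerD fp gq. Qed.

Lemma polyfunM f g : polyfun f -> polyfun g -> polyfun (fun x => f x * g x).
Proof. by move=> [p fp] [q gq]; exists (p * q) => x; rewrite hornerM fp gq. Qed.

Lemma polyfunB f g : polyfun f -> polyfun g -> polyfun (fun x => f x - g x).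
Proof. by move=> [p fp] [q gq]; exists (p - q) => x; rewrite !hornerE fp gq. Qed.

Lemma polyfun_sum n (F : nat -> R -> R) : (forall i, polyfun (F i)) ->
  polyfun (fun x => \sum_(i < n) F i x).
Proof.
move=> Fp; elim: n => [|n IHn].
  by exists 0 => x; rewrite big_ord0 horner0.
have [p pE] := polyfunD IHn (Fp n).
by exists p => x; rewrite big_ord_recr -pE.
Qed.

Lemma polyfun_prod n (F : nat -> R -> R) : (forall i, polyfun (F i)) ->
  polyfun (fun x => \prod_(i < n) F i x).
Proof.
move=> Fp; elim: n => [|n IHn].
  by exists 1 => x; rewrite big_ord0 hornerC.
have [p pE] := polyfunM IHn (Fp n).
by exists p => x; rewrite big_ord_recr -pE.
Qed.

(** Such an [f] takes the value [f 0] at every natural number, so [p - f 0] has more roots than its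
    degree allows; they are distinct in characteristic 0. *)
Lemma polyfun_periodic f : polyfun f -> (forall x, f (x + 1) = f x) ->
  forall x, f x = f 0.
Proof.
move=> [p fp] per x; have fn n : f n%:R = f 0.
  by elim: n => // n IHn; rewrite -addn1 natrD per.
suff p0 : p - (f 0)%:P = 0.
  by apply/eqP; rewrite -subr_eq0 [f x]fp -(hornerC (f 0) x) -hornerN -hornerD p0 horner0.
apply: (@roots_geq_poly_eq0 _ _ [seq i%:R | i <- iota 0 (size (p - (f 0)%:P))]).
- apply/allP => _ /mapP[i _ ->].
  by rewrite /root !hornerE -fp fn subrr.
- by rewrite map_inj_uniq ?iota_uniq//; exact: mulrIn (oner_neq0 R).
- by rewrite size_map size_iota.
Qed.

End polynomial_functions.

Section rothe.
Context {R : numFieldType}.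
Variable beta : R.

(** [ffact1 a k / k!] is the generalized binomial coefficient of [a - 1] over [k]. *)
Definition ffact1 (a : R) k := \prod_(j < k) (a - j.+1%:R).

Lemma ffact1S a k : ffact1 a k.+1 = ffact1 a k * (a - k.+1%:R).
Proof. by rewrite /ffact1 big_ord_recr. Qed.

Lemma ffact1D1S a k : ffact1 (a + 1) k.+1 = a * ffact1 a k.
Proof.
rewrite /ffact1 big_ord_recl; congr (_ * _); first by rewrite addrK.
by apply: eq_bigr => i _; rewrite lift0 -(natr1 i.+1) opprD addrACA subrr addr0.
Qed.

(* If [B] is the power series solution of [B = 1 - z B^beta], then [rothe n x]
   and [rothe' n x] are the coefficients of [z^n] in [B^x] and
   [z (log B)' B^x]. *)
Definition rothe' n x :=
  if n is k.+1 then (-1) ^+ n * ffact1 (x + beta * n%:R) k / k`!%:R else 0.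

Definition rothe n x := if n is _.+1 then x * rothe' n x / n%:R else 1.

Lemma polyfun_rothe' n : polyfun (rothe' n).
Proof.
case: n => [|k]; first exact: polyfun_cst.
have lin j : polyfun (fun x => x + beta * k.+1%:R - j.+1%:R).
  exact: (polyfunB (polyfunD polyfun_id (polyfun_cst _)) (polyfun_cst _)).
exact: (polyfunM (polyfunM (polyfun_cst _) (polyfun_prod k lin)) (polyfun_cst _)).
Qed.

Lemma polyfun_rothe n : polyfun (rothe n).
Proof.
case: n => [|k]; first exact: polyfun_cst.
exact: (polyfunM (polyfunM polyfun_id (polyfun_rothe' _)) (polyfun_cst _)).
Qed.

(** This is [B^(x+1) - B^x = - z B^(x+beta)], that is [B = 1 - z B^beta] times [B^x], multiplied by
    [z (log B)'] and read on coefficients. For the closed form it is a Pascal rule: the two products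
    on the left share the factor [ffact1 a k]. *)
Lemma rothe'_diff n x : rothe' n.+1 (x + 1) - rothe' n.+1 x = - rothe' n (x + beta).
Proof.
case: n => [|k] /=; first by rewrite /ffact1 !big_ord0 subrr oppr0.
set a := x + beta * k.+2%:R.
have -> : x + 1 + beta * k.+2%:R = a + 1 by rewrite /a addrAC.
have -> : x + beta + beta * k.+1%:R = a.
  by rewrite /a -[k.+2%:R]natr1 mulrDr mulr1 addrA addrAC.
rewrite ffact1D1S ffact1S factS natrM [in LHS]exprS.
have k0 : k`!%:R != 0 :> R by rewrite pnatr_eq0 -lt0n fact_gt0.
have k1 : k.+1%:R != 0 :> R by rewrite pnatr_eq0.
by field; rewrite k0 nat1r k1.
Qed.

Lemma rothe_diff n x : rothe n.+1 (x + 1) - rothe n.+1 x = - rothe n (x + beta).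
Proof.
case: n => [|k]; rewrite /rothe /=.
  by rewrite /ffact1 !big_ord0 fact0; field.
set a := x + beta * k.+2%:R.
have -> : x + 1 + beta * k.+2%:R = a + 1 by rewrite /a addrAC.
have -> : x + beta + beta * k.+1%:R = a.
  by rewrite /a -[k.+2%:R]natr1 mulrDr mulr1 addrA addrAC.
rewrite ffact1D1S ffact1S factS natrM [in LHS]exprS /a.
have k0 : k`!%:R != 0 :> R by rewrite pnatr_eq0 -lt0n fact_gt0.
have k1 : k.+1%:R != 0 :> R by rewrite pnatr_eq0.
have k2 : k.+2%:R != 0 :> R by rewrite pnatr_eq0.
by field; rewrite k0 nat1r k1 -natrD add2n k2.
Qed.

(* By [rothe_diff] and induction, the difference of the two sides is a
   polynomial in [y] of period 1, hence its value at [y = 0], which is 0. *)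
Lemma rothe_conv n y :
  \sum_(k < n.+1) rothe' k 0 * rothe (n - k) y = rothe' n y.
Proof.
elim: n y => [|n IHn] y; first by rewrite big_ord1 mul0r.
pose D y := \sum_(k < n.+2) rothe' k 0 * rothe (n.+1 - k) y - rothe' n.+1 y.
suff : D y = 0 by move/eqP; rewrite subr_eq0 => /eqP.
have D0 : D 0 = 0.
  rewrite /D big_ord_recr big1 /= ?subnn ?add0r ?mulr1 ?subrr// => i _.
  by rewrite subSn ?leq_ord//= !mul0r mulr0.
rewrite -D0; apply: polyfun_periodic => [|x].
  have term k : polyfun (fun y => rothe' k 0 * rothe (n.+1 - k) y).
    exact: (polyfunM (polyfun_cst _) (polyfun_rothe _)).
  exact: (polyfunB (polyfun_sum n.+2 term) (polyfun_rothe' _)).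
apply/eqP; rewrite -subr_eq0 /D !(big_ord_recr n.+1)/= !subnn.
rewrite [X in X == _](_ : _ =
    \sum_(i < n.+1) rothe' i 0 * (rothe (n.+1 - i) (x + 1) - rothe (n.+1 - i) x)
    - (rothe' n.+1 (x + 1) - rothe' n.+1 x)); last first.
  under [in RHS]eq_bigr do rewrite mulrBr.
  by rewrite sumrB /=; ring.
rewrite rothe'_diff -IHn.
under eq_bigr do rewrite subSn ?leq_ord// rothe_diff mulrN.
by rewrite sumrN opprK addNr.
Qed.

(** The formal differential equation [z (B^y)' = y (z (log B)') B^y], from which the sums of these
    series are computed. *)
Lemma rothe_rec n y :
  n%:R * rothe n y = y * \sum_(k < n.+1) rothe' k 0 * rothe (n - k) y.
Proof.
rewrite rothe_conv; case: n => [|n]; first by rewrite mul0r mulr0.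
by rewrite mulrC /rothe divfK// pnatr_eq0.
Qed.

(** The equation [B = 1 - z B^beta] on coefficients: the case [x = 0] of [rothe_diff], where
    [rothe n.+1 0] vanishes. *)
Lemma rotheS1 n : rothe n.+1 1 = - rothe n beta.
Proof.
have := rothe_diff n 0; rewrite !add0r => <-.
by rewrite /rothe !mul0r subr0.
Qed.

End rothe.

(** The factor [x - j] has absolute value at most [m + 1 - j] if [j <= m], and at most [j - m] if
    [j > m]. Truncated subtraction covers both ranges of [k]: one of the two factorials of a
    difference is always [0!]. *)
Lemma ffact1_le (R : realFieldType) (x : R) m k : m%:R <= x < m.+1%:R ->
  `|ffact1 x k| * (m - k)`!%:R <= m`!%:R * (k - m)`!%:R.
Proof.
rewrite -natr1 => /andP[mx xm]; elim: k => [|k IHk].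
  by rewrite /ffact1 big_ord0 normr1 mul1r subn0 fact0 mulr1.
rewrite ffact1S normrM -[k.+1%:R]natr1; have [km|mk] := ltnP k m.
  have -> : (k.+1 - m = 0)%N by lia.
  move: IHk; have -> : (k - m = 0)%N by lia.
  apply: le_trans; rewrite -mulrA ler_wpM2l//.
  have -> : (m - k = (m - k.+1).+1)%N by lia.
  rewrite factS natrM ler_wpM2r//.
  have -> : ((m - k.+1).+1 = m - k)%N by lia.
  have kx : k%:R + 1 <= m%:R :> R by rewrite natr1 ler_nat.
  by rewrite natrB 1?ltnW// ger0_norm; lra.
have -> : (m - k.+1 = 0)%N by lia.
move: IHk; have -> : (m - k = 0)%N by lia.
rewrite fact0 !mulr1 => IHk.
rewrite subSn// factS natrM mulrCA [leRHS]mulrC; apply: ler_pM => //.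
have kx : m%:R <= k%:R :> R by rewrite ler_nat.
by rewrite -natr1 natrB// ler0_norm; lra.
Qed.

(* The maximum of [x `^ beta * (1 - x) `^ (1 - beta)] on the unit interval; its
   inverse is the limit of [b_fun (1 - beta)] at 0 and the radius of convergence
   of the series below. *)
Definition critical_value (R : realType) (beta : R) :=
  beta `^ beta * (1 - beta) `^ (1 - beta).

Lemma critical_value_gt0 (R : realType) (beta : R) :
  0 < beta < 1 -> 0 < critical_value beta.
Proof. by case/andP=> ? ?; rewrite mulr_gt0 ?powR_gt0 ?subr_gt0. Qed.

Section bounds.
Context {R : realType}.
Variable beta : R.
Hypothesis beta01 : 0 < beta < 1.

(* The [N.+1] weights of the binomial law sum to 1 and [m] is its mode. *)
Lemma binomial_mode_ge N m : m%:R <= N.+1%:R * beta < m.+1%:R ->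
  1 <= N.+1%:R * ('C(N, m)%:R * beta ^+ m * (1 - beta) ^+ (N - m)).
Proof.
move: beta01 => /andP[beta0 beta1] /andP[mb bm].
pose T k := 'C(N, k)%:R * beta ^+ k * (1 - beta) ^+ (N - k).
have T0 k : 0 <= T k by rewrite /T !mulr_ge0// exprn_ge0//; lra.
have TS k : (k < N)%N ->
    T k.+1 * (k.+1%:R * (1 - beta)) = T k * ((N - k)%:R * beta).
  move=> kN; have := mul_bin_left N k => /(congr1 (fun n => n%:R : R)).
  rewrite !natrM /T => E.
  transitivity ((k.+1%:R * 'C(N, k.+1)%:R) *
    (beta ^+ k.+1 * (1 - beta) ^+ (N - k.+1) * (1 - beta))).
    by ring.
  have -> : (1 - beta) ^+ (N - k) = (1 - beta) * (1 - beta) ^+ (N - k.+1).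
    by rewrite -exprS; congr (_ ^+ _); lia.
  by rewrite E exprS; ring.
have mN : (m <= N)%N.
  rewrite -ltnS -(ltr_nat R); apply: le_lt_trans mb _.
  by rewrite gtr_pMr.
have up k : (k < m)%N -> T k <= T k.+1.
  move=> km; have kN : (k < N)%N by lia.
  have p0 : 0 < (N - k)%:R * beta.
    by rewrite mulr_gt0// ltr0n subn_gt0.
  rewrite -(ler_pM2r p0) -TS// ler_wpM2l//.
  have : k.+1%:R <= m%:R :> R by rewrite ler_nat.
  by rewrite natrB ?(ltnW kN)//; move: mb; rewrite -!natr1; lra.
have down k : (m <= k < N)%N -> T k.+1 <= T k.
  move=> /andP[mk kN].
  have p0 : 0 < k.+1%:R * (1 - beta) by rewrite mulr_gt0// subr_gt0.
  rewrite -(ler_pM2r p0) TS// ler_wpM2l//.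
  have : m.+1%:R <= k.+1%:R :> R by rewrite ler_nat.
  by rewrite natrB ?(ltnW kN)//; move: bm; rewrite -!natr1; lra.
have upm j : (j <= m)%N -> T (m - j)%N <= T m.
  elim: j => [|j IHj jm]; first by rewrite subn0.
  apply: le_trans (IHj (ltnW jm)).
  rewrite [leRHS](_ : _ = T (m - j.+1).+1); first by apply: up; lia.
  by congr T; lia.
have downm j : (m + j <= N)%N -> T (m + j)%N <= T m.
  elim: j => [|j IHj jm]; first by rewrite addn0.
  apply: le_trans (IHj _); last by lia.
  by rewrite addnS; apply: down; lia.
have TT k : (k <= N)%N -> T k <= T m.
  move=> kN; have [km|mk] := leqP k m.
    by rewrite -(subKn km); apply: upm; lia.
  by rewrite -(subnKC (ltnW mk)); apply: downm; lia.
rewrite [leLHS](_ : 1 = \sum_(k < N.+1) T k); last first.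
  rewrite -{1}(expr1n _ N) -{1}(subrK beta 1) exprDn.
  by apply: eq_bigr => i _; rewrite /T -mulr_natl; ring.
apply: le_trans (_ : \sum_(k < N.+1) T m <= _).
  by apply: ler_sum => i _; rewrite TT// -ltnS.
by rewrite sumr_const card_ord [leRHS]mulr_natl.
Qed.

Local Notation t0 := (critical_value beta).
Let t0_gt0 : 0 < t0 := critical_value_gt0 beta01.

(** With [m] the integer part of [beta * n.+1], [ffact1_le] gives at most
    [m! (n - m)! = n! / 'C(n, m)], and [binomial_mode_ge] bounds the inverse binomial coefficient
    sharply up to the factor [n.+1]. The case [k = n] serves [rothe' _ 0], and [k = n - 1] serves
    [rothe _ 1]. *)
Lemma ffact1_bound n k : (k <= n <= k.+1)%N ->
  `|ffact1 (beta * n.+1%:R) k| <=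
    n`!%:R * n.+1%:R * (t0 ^+ n.+1 / (beta * (1 - beta))).
Proof.
move: beta01 => /andP[beta0 beta1] /andP[kn nk].
have alpha0 : 0 < 1 - beta by rewrite subr_gt0.
have [m /andP[mx xm]] : exists m, m%:R <= beta * n.+1%:R < m.+1%:R.
  exists (Num.truncn (beta * n.+1%:R)).
  by apply: Num.Theory.truncn_itv => //; rewrite mulr_ge0// ltW.
have mn : (m <= n)%N.
  rewrite -ltnS -(ltr_nat R); apply: le_lt_trans mx _.
  by rewrite gtr_pMl.
have := @binomial_mode_ge n m; rewrite mulrC mx xm => /(_ isT) mode.
have E : 'C(n, m)%:R * (m`!%:R * (n - m)`!%:R) = n`!%:R :> R.
  by rewrite -!natrM bin_fact.
apply: (@le_trans _ _ (m`!%:R * (n - m)`!%:R)).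
  apply: le_trans (_ : m`!%:R * (k - m)`!%:R <= _); last first.
    by rewrite ler_wpM2l// ler_nat; exact/leq_fact/leq_sub2r.
  apply: le_trans (ffact1_le k (introT andP (conj mx xm))).
  by rewrite ler_peMr// ler1n fact_gt0.
rewrite -E; set F := m`!%:R * _.
have -> : 'C(n, m)%:R * F * n.+1%:R * (t0 ^+ n.+1 / (beta * (1 - beta))) =
   F * (n.+1%:R * ('C(n, m)%:R * (t0 ^+ n.+1 / (beta * (1 - beta))))) by ring.
rewrite ler_peMr ?mulr_ge0//; apply: le_trans mode _.
rewrite ler_wpM2l// -mulrA ler_wpM2l//.
(* These real exponents bound [m] and [n - m] from below; as the bases are less than 1, passing to
   them enlarges the product. *)
have tE : t0 ^+ n.+1 / (beta * (1 - beta)) =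
    beta `^ (beta * n.+1%:R - 1) * (1 - beta) `^ ((1 - beta) * n.+1%:R - 1).
  rewrite /critical_value exprMn -!powR_mulrn ?powR_ge0// -!powRrM !powRB
      ?(gt_eqF beta0) ?(gt_eqF alpha0) ?implybT//.
  by rewrite !powRr1 ?(ltW beta0) ?(ltW alpha0)// invfM mulrACA.
rewrite tE -!powR_mulrn ?(ltW beta0) ?(ltW alpha0)//.
have mn' : (n - m)%:R = n%:R - m%:R :> R by rewrite natrB.
rewrite mn'; apply: ler_pM; rewrite ?powR_ge0//; apply: ger_powR.
- by rewrite beta0 ltW.
- by move: xm; rewrite -!natr1; lra.
- by lra.
- by move: mx; rewrite -!natr1; lra.
Qed.

Definition geom_bounded (t : R) (a : nat -> R) :=
  exists K, forall n, `|a n| <= K * n.+1%:R * t ^+ n.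

Lemma rothe'_bounded : geom_bounded t0 (fun n => rothe' beta n 0).
Proof.
move: beta01 => /andP[beta0 beta1].
exists (beta * (1 - beta))^-1 => -[|n] /=.
  by rewrite normr0 expr0 !mulr1 invr_ge0 mulr_ge0 ?subr_ge0 ?ltW.
rewrite add0r !normrM normrX normrN1 expr1n mul1r normfV normr_nat ler_pdivrMr ?ltr0n ?fact_gt0//.
apply: le_trans (ffact1_bound _) _; first by rewrite leqnn leqnSn.
rewrite [leRHS](_ : _ = n`!%:R * n.+2%:R * (t0 ^+ n.+1 / (beta * (1 - beta)))); last by ring.
have D0 : 0 <= t0 ^+ n.+1 / (beta * (1 - beta)).
  by rewrite divr_ge0 ?exprn_ge0 ?(ltW t0_gt0)// mulr_ge0 ?subr_ge0// ltW.
by rewrite ler_wpM2r// ler_wpM2l// ler_nat.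
Qed.

Lemma rothe1_bounded : geom_bounded t0 (fun n => rothe beta n 1).
Proof.
move: beta01 => /andP[beta0 beta1].
have K0 : 0 <= (beta * (1 - beta))^-1.
  by rewrite invr_ge0 mulr_ge0 ?subr_ge0 ?ltW.
(* The three summands serve [n = 0], [n = 1] and [n >= 2] respectively. *)
exists (1 + t0^-1 + (beta * (1 - beta))^-1) => -[|[|n]].
- rewrite /= normr1 expr0 !mulr1.
  have : 0 < t0^-1 by rewrite invr_gt0.
  by lra.
- rewrite /rothe /rothe' /ffact1 big_ord0 fact0 !(mulr1, invr1, mul1r) expr1 normrN1.
  rewrite -ler_pdivrMr// div1r.
  have : 0 < t0^-1 by rewrite invr_gt0.
  by lra.
rewrite /rothe mul1r /rothe' addrC ffact1D1S.
set F := ffact1 _ _; 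
have -> : `|(-1) ^+ n.+2 * (beta * n.+2%:R * F) / (n.+1)`!%:R / n.+2%:R| =
    beta * n.+2%:R * `|F| / (n.+1)`!%:R / n.+2%:R.
  have -> : forall x y z w v : R, 
      `|x * (y * z * w) / v / z| = `|x| * (`|y| * `|z| * `|w|) / `|v| / `|z|.
    by move=> *; rewrite !normrM !normfV.
  rewrite !normr_nat normrX normrN1 expr1n mul1r.
  by rewrite (ger0_norm (ltW beta0)).
rewrite ler_pdivrMr ?ltr0n// ler_pdivrMr ?ltr0n ?fact_gt0//.
apply: le_trans (_ : 1 * n.+2%:R * ((n.+1)`!%:R * n.+2%:R *
    (t0 ^+ n.+2 / (beta * (1 - beta)))) <= _).
  apply: ler_pM; rewrite ?mulr_ge0 ?(ltW beta0)//.
    by rewrite ler_wpM2r// ltW.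
  by apply: ffact1_bound; rewrite leqnSn leqnn.
rewrite mul1r [leRHS](_ : _ = n.+2%:R * ((n.+1)`!%:R * n.+3%:R *
   (t0 ^+ n.+2 * (1 + t0^-1 + (beta * (1 - beta))^-1)))); last by ring.
have T0 : 0 <= t0 ^+ n.+2 by rewrite exprn_ge0 ?ltW.
rewrite ler_wpM2l//; apply: ler_pM => //; first exact: mulr_ge0 T0 K0.
  by rewrite ler_wpM2l// ler_nat.
rewrite ler_wpM2l//; have : 0 < t0^-1 by rewrite invr_gt0.
by lra.
Qed.

(** By [rotheS1] this is [rothe1_bounded] shifted by one: the shift costs [t0], and
    [n.+2 <= 2 * n.+1]. *)
Lemma rothe_beta_bounded : geom_bounded t0 (fun n => rothe beta n beta).
Proof.
have [K K_ge] := rothe1_bounded.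
exists (K * 2 * t0) => n; rewrite -normrN -rotheS1; apply: le_trans (K_ge _) _.
have K0 : 0 <= K.
  by have := le_trans (normr_ge0 _) (K_ge 0%N); rewrite expr0 !mulr1.
rewrite exprS [leRHS](_ : _ = K * (2 * n.+1%:R) * (t0 * t0 ^+ n)); last by ring.
have T0 : 0 <= t0 * t0 ^+ n by rewrite -exprS exprn_ge0// ltW.
rewrite ler_wpM2r// ler_wpM2l// -natrM ler_nat.
by lia.
Qed.

End bounds.

(** * Power series *)

Section cauchy_product.
Context {R : realType}.
Implicit Types u v : R^nat.

Definition conv u v : R^nat := fun n => \sum_(k < n.+1) u k * v (n - k)%N.

Lemma series_conv u v N :
  series (conv u v) N = \sum_(k < N) u k * series v (N - k)%N.
Proof.
elim: N => [|N IHN]; first by rewrite /series/= big_nil big_ord0.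
rewrite seriesSr IHN.
rewrite /conv !big_ord_recr/= subSnn addrA -big_split/=; congr (_ + _).
  by apply: eq_bigr => i _; rewrite subSn 1?ltnW// /series/= big_nat_recr// mulrDr.
by rewrite /series/= big_nat1 subnn.
Qed.

(** Sandwich: the triangle of indices [i + j < N] lies in the square of side [N], which lies in the
    triangle of size [2 N]. *)
Lemma ge0_cvg_conv u v : (forall n, 0 <= u n) -> (forall n, 0 <= v n) ->
  cvgn (series u) -> cvgn (series v) ->
  series (conv u v) @ \oo --> limn (series u) * limn (series v).
Proof.
move=> u0 v0 cu cv; set l := _ * _.
have conv0 n : 0 <= conv u v n by apply: sumr_ge0 => i _; rewrite mulr_ge0.
have ndu : nondecreasing_seq (series u) by exact: nondecreasing_series.
have ndv : nondecreasing_seq (series v) by exact: nondecreasing_series.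
have ndc : nondecreasing_seq (series (conv u v)) by exact: nondecreasing_series.
have su0 n : 0 <= series u n by apply: sumr_ge0.
have sv0 n : 0 <= series v n by apply: sumr_ge0.
have cl : (fun n => series u n * series v n) @ \oo --> l by exact: cvgM.
have ub N : series (conv u v) N <= series u N * series v N.
  rewrite series_conv /(series u) /= big_mkord mulr_suml; apply: ler_sum => i _.
  by rewrite ler_wpM2l// ndv// leq_subr.
have lb N : series u N * series v N <= series (conv u v) (N + N)%N.
  rewrite series_conv big_split_ord/= /(series u) /= big_mkord mulr_suml.
  rewrite -[leLHS]addr0 lerD//.
    apply: ler_sum => i _; rewrite ler_wpM2l// ndv//; have := ltn_ord i; lia.
  by apply: sumr_ge0 => i _; rewrite mulr_ge0.
have ul N : series u N * series v N <= l.
  by apply: ler_pM => //; exact: nondecreasing_cvgn_le.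
have cc : cvgn (series (conv u v)).
  apply: nondecreasing_is_cvgn => //; exists l => _ [n _ <-].
  exact: le_trans (ub n) (ul n).
suff -> : l = limn (series (conv u v)) by [].
apply/eqP; rewrite eq_le; apply/andP; split; last first.
  by apply: limr_le => //; near=> n; exact: le_trans (ub n) (ul n).
rewrite -(cvg_lim _ cl)//; apply: limr_le; first by apply/cvg_ex; exists l.
by near=> n; apply: le_trans (lb n) _; exact: nondecreasing_cvgn_le.
Unshelve. all: by end_near. Qed.

(** Let [D] be the sum over the square minus the sum over the triangle. For [u] and [v] it is
    dominated termwise by its analogue for the absolute values, which tends to 0 by the nonnegative
    case. *)
Lemma cvg_conv u v :
  cvgn (series (fun n => `|u n|)) -> cvgn (series (fun n => `|v n|)) ->
  series (conv u v) @ \oo --> limn (series u) * limn (series v).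
Proof.
move=> cu cv.
have cuv := ge0_cvg_conv (fun=> normr_ge0 _) (fun=> normr_ge0 _) cu cv.
set nu := fun n => `|u n| in cu cuv; set nv := fun n => `|v n| in cv cuv.
pose D u v N : R := series u N * series v N - series (conv u v) N.
have DE u' v' N : D u' v' N =
    \sum_(k < N) u' k * (series v' N - series v' (N - k)%N).
  rewrite /D series_conv /(series u') /= big_mkord mulr_suml -sumrB.
  by apply: eq_bigr => i _; rewrite mulrBr.
have D_le N : `|D u v N| <= D nu nv N.
  rewrite !DE; apply: le_trans (ler_norm_sum _ _ _) _; apply: ler_sum => i _.
  rewrite normrM ler_wpM2l// !sub_series_geq ?leq_subr//.
  exact: ler_norm_sum.
have D0 : D nu nv @ \oo --> (0 : R).
  rewrite -(subrr (limn (series nu) * limn (series nv))).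
  by apply: cvgB => //; exact: cvgM.
have DD : D u v @ \oo --> (0 : R).
  apply/norm_cvg0P; apply: (squeeze_cvgr _ (cvg_cst 0) D0).
  by near=> n; rewrite normr_ge0 D_le.
have -> : series (conv u v) = (fun n => series u n * series v n - D u v n).
  by apply/funext => n; rewrite /D subKr.
rewrite -[X in _ --> X]subr0; apply: cvgB DD.
by apply: cvgM; exact: normed_cvg.
Unshelve. all: by end_near. Qed.

End cauchy_product.

Section power_series.
Context {R : realType}.
Variable rho : R.

(* The radius of convergence of the power series is at least [rho]. *)
Definition radius_ge (a : R^nat) :=
  forall x, 0 <= x < rho -> exists M, forall n, `|a n| * x ^+ n <= M.

Lemma radius_geW a b : radius_ge a -> (forall n, `|b n| <= `|a n|) -> radius_ge b.
Proof.
move=> ra ba x x01; have [M aM] := ra _ x01; exists M => n.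
move: x01 => /andP[x0 _].
by apply: le_trans (aM n); rewrite ler_wpM2r ?exprn_ge0.
Qed.

(** A factor [n] is paid for by enlarging [x] to any [y > x]: the formal derivative keeps the
    radius, and the linear factor in [geom_bounded] is harmless. *)
Lemma mulrn_expr_le (x y : R) n : 0 <= x <= y ->
  n%:R * (y - x) * x ^+ n <= y * y ^+ n.
Proof.
move=> /andP[x0 xy]; have y0 := le_trans x0 xy.
elim: n => [|n IHn]; first by rewrite !mul0r expr0 mulr1.
rewrite !exprS [leLHS](_ : _ = x * (n%:R * (y - x) * x ^+ n) +
  (y - x) * (x * x ^+ n)); last first.
  by rewrite -natr1; ring.
rewrite [leRHS](_ : _ = x * (y * y ^+ n) + (y - x) * (y * y ^+ n)); last by ring.
rewrite lerD// ler_wpM2l ?subr_ge0// ler_pM ?exprn_ge0//.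
by rewrite lerXn2r.
Qed.

Lemma radius_ge_mulrn a : radius_ge a -> radius_ge (fun n => n%:R * a n).
Proof.
move=> ra x /andP[x0 xrho]; pose y := (x + rho) / 2.
have xy : x < y by rewrite /y; lra.
have [|M aM] := ra y; first by apply/andP; rewrite /y; split; lra.
exists (y * M / (y - x)) => n; rewrite ler_pdivlMr ?subr_gt0// normrM normr_nat.
rewrite [leLHS](_ : _ = `|a n| * (n%:R * (y - x) * x ^+ n)); last by ring.
apply: le_trans (_ : `|a n| * (y * y ^+ n) <= _).
  by rewrite ler_wpM2l// mulrn_expr_le// x0 ltW.
rewrite mulrCA ler_wpM2l//; lra.
Qed.

Lemma radius_ge_shift a : radius_ge a -> radius_ge (fun n => a n.+1).
Proof.
move=> ra x /andP[x0 xrho]; have [y /andP[xy yrho]] : exists y, x < y < rho.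
  by exists ((x + rho) / 2); rewrite !midf_lt.
have y0 : 0 < y by lra.
have [|M aM] := ra y; first by rewrite (ltW y0).
exists (M / y) => n; rewrite ler_pdivlMr//; apply: le_trans (aM n.+1).
rewrite exprSr mulrA ler_wpM2r ?(ltW y0)// ler_wpM2l//.
by rewrite lerXn2r ?nnegrE// ltW.
Qed.

Lemma radius_ge_diffs a : radius_ge a -> radius_ge (pseries_diffs a).
Proof. by move=> /radius_ge_mulrn /radius_ge_shift. Qed.

Lemma radius_ge_cvg a x : radius_ge a -> `|x| < rho ->
  cvgn (series (fun n => `|a n * x ^+ n|)).
Proof.
move=> ra xrho; have [y /andP[xy yrho]] : exists y, `|x| < y < rho.
  by exists ((`|x| + rho) / 2); rewrite !midf_lt.
have y0 : 0 < y by apply: le_lt_trans xy.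
have [|M aM] := ra y; first by rewrite (ltW y0).
have M0 : 0 <= M by apply: le_trans (aM 0%N); rewrite expr0 mulr1.
have q0 : 0 <= `|x| / y by rewrite divr_ge0// ltW.
apply: (@series_le_cvg _ _ (geometric M (`|x| / y))) => // [n|n|].
- by rewrite /geometric/= mulr_ge0// exprn_ge0.
- rewrite /geometric/= expr_div_n mulrA ler_pdivlMr ?exprn_gt0//.
  by rewrite normrM normrX mulrAC ler_wpM2r// exprn_ge0.
- by apply: is_cvg_geometric_series; rewrite (ger0_norm q0) ltr_pdivrMr// mul1r.
Qed.

Lemma radius_ge_cvg_pseries a x : radius_ge a -> `|x| < rho -> cvgn (pseries a x).
Proof. by move=> ra xrho; apply: normed_cvg; exact: radius_ge_cvg. Qed.

Definition psum (a : R^nat) x := limn (pseries a x).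

Lemma is_derive_psum a (x : R) : radius_ge a -> `|x| < rho ->
  is_derive x (1 : R) (psum a) (psum (pseries_diffs a) x).
Proof.
move=> ra xrho; have [y /andP[xy yrho]] : exists y, `|x| < y < rho.
  by exists ((`|x| + rho) / 2); rewrite !midf_lt.
have y0 : 0 < y by apply: le_lt_trans xy.
rewrite -(gtr0_norm y0) in xy yrho.
apply: (@pseries_snd_diffs _ a y) => //; apply: radius_ge_cvg_pseries => //.
  exact: radius_ge_diffs.
by do 2!apply: radius_ge_diffs.
Qed.

Lemma psum0 a : psum a 0 = a 0%N.
Proof.
apply: cvg_lim => //; rewrite -cvg_shiftS.
rewrite (_ : [sequence _]_n = cst (a 0%N)); first exact: cvg_cst.
apply/funext => n; rewrite /pseries /series/= big_nat_recl//= expr0 mulr1.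
by rewrite big1 ?addr0// => i _; rewrite expr0n mulr0.
Qed.

Lemma cvg_psum_conv a b x : radius_ge a -> radius_ge b -> `|x| < rho ->
  pseries (conv a b) x @ \oo --> psum a x * psum b x.
Proof.
move=> ra rb xrho; have := cvg_conv (radius_ge_cvg ra xrho) (radius_ge_cvg rb xrho).
rewrite (_ : conv _ _ = fun n => conv a b n * x ^+ n)//; apply/funext => n.
rewrite /conv mulr_suml; apply: eq_bigr => i _.
by rewrite mulrACA -exprD subnKC// -ltnS.
Qed.

End power_series.

Section psum_extra.
Context {R : realType}.
Variable rho : R.

Lemma geom_bounded_radius_ge (t : R) (a : R^nat) : 0 < t -> geom_bounded t a ->
  radius_ge t^-1 a.
Proof.
move=> t0 [K aK] x /andP[x0 xt].
have K0 : 0 <= K by have := le_trans (normr_ge0 _) (aK 0%N); rewrite expr0 !mulr1.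
have xt1 : x * t < 1 by rewrite -ltr_pdivlMr// div1r.
have q0 : 0 <= x * t by rewrite mulr_ge0// ltW.
exists (K * ((1 - x * t)^-1 + 1)) => n.
apply: le_trans (_ : K * n.+1%:R * t ^+ n * x ^+ n <= _).
  by rewrite ler_wpM2r// exprn_ge0.
rewrite -!mulrA -exprMn [t * x]mulrC ler_wpM2l//.
have : n%:R * (1 - x * t) * (x * t) ^+ n <= 1 * 1 ^+ n.
  by apply: mulrn_expr_le; rewrite q0 ltW.
rewrite expr1n mulr1 -natr1 mulrDl mul1r => nq; apply: lerD; last first.
  by rewrite exprn_ile1// ltW.
by rewrite -[leRHS]div1r ler_pdivlMr ?subr_gt0// mulrAC.
Qed.

Lemma psum_lin (a b : R^nat) c d (x : R) : radius_ge rho a -> radius_ge rho b ->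
  `|x| < rho -> psum (fun n => c * a n + d * b n) x = c * psum a x + d * psum b x.
Proof.
move=> ra rb xrho; apply: cvg_lim => //.
have -> : pseries (fun n => c * a n + d * b n) x =
    (fun n => c * pseries a x n + d * pseries b x n).
  apply/funext => n; rewrite /pseries /series/= !mulr_sumr -big_split/=.
  by apply: eq_bigr => i _; rewrite mulrDl !mulrA.
by apply: cvgD; apply: (cvgM (cvg_cst _)); apply: radius_ge_cvg_pseries xrho.
Qed.

Lemma psumS (a : R^nat) (x : R) : radius_ge rho a -> `|x| < rho ->
  psum a x = a 0%N + x * psum (fun n => a n.+1) x.
Proof.
move=> ra xrho; apply: cvg_lim => //; rewrite -cvg_shiftS.
rewrite (_ : [sequence _]_n =
    (fun n => a 0%N + x * pseries (fun n => a n.+1) x n)); last first.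
  apply/funext => n; rewrite /pseries /series/= big_nat_recl//= expr0 mulr1.
  by congr (_ + _); rewrite mulr_sumr; apply: eq_bigr => i _; rewrite exprS; ring.
apply: cvgD; first exact: cvg_cst.
apply: (cvgM (cvg_cst _)); apply: radius_ge_cvg_pseries xrho.
exact: radius_ge_shift.
Qed.

Lemma is_derive0_cst (f : R -> R) (b : R) : 0 <= b ->
  (forall x : R, 0 <= x <= b -> is_derive x (1 : R) f 0) -> f b = f 0.
Proof.
rewrite le_eqVlt => /predU1P[<-//|b0] df.
have [||c _] := @MVT R f (fun=> 0) 0 b b0.
- by move=> x; rewrite in_itv/= => /andP[x0 xb]; apply: df; rewrite !ltW.
- apply: derivable_within_continuous => x; rewrite in_itv/= => xb.
  by have [] := df _ xb.
- by rewrite mul0r => /eqP; rewrite subr_eq0 => /eqP.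
Qed.

(* The real form of: if G' = y L' G with L = p + i q and G = f + i k, then
   G exp(- y L) is constant. *)
Lemma complex_exp_ode (p q f k dp dq : R -> R) (y b : R) : 0 <= b ->
  (forall x : R, 0 <= x <= b ->
    [/\ is_derive x (1 : R) p (dp x), is_derive x (1 : R) q (dq x),
        is_derive x (1 : R) f (y * (dp x * f x - dq x * k x)) &
        is_derive x (1 : R) k (y * (dp x * k x + dq x * f x))]) ->
  p 0 = 0 -> q 0 = 0 -> f 0 = 1 -> k 0 = 0 ->
  f b = expR (y * p b) * cos (y * q b) /\ k b = expR (y * p b) * sin (y * q b).
Proof.
move=> b0 D p0 q0 f0 k0.
(* Real and imaginary parts of [(f + i k) exp(- y (p + i q))]. *)
pose A x := expR (- (y * p x)) * (f x * cos (y * q x) + k x * sin (y * q x)).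
pose B x := expR (- (y * p x)) * (k x * cos (y * q x) - f x * sin (y * q x)).
have AB x : 0 <= x <= b -> is_derive x (1 : R) A 0 /\ is_derive x (1 : R) B 0.
  move=> /D[Dp Dq Df Dk].
  have Dyp : is_derive x (1 : R) (fun x => - (y * p x)) (- (y * dp x)).
    by apply: is_deriveN; apply: is_deriveZ.
  have Dyq : is_derive x (1 : R) (fun x => y * q x) (y * dq x).
    by apply: is_deriveZ.
  have De := is_derive1_comp (is_derive_expR _) Dyp.
  have Dc := is_derive1_comp (is_derive_cos _) Dyq.
  have Ds := is_derive1_comp (is_derive_sin _) Dyq.
  split.
    apply: is_derive_eq (is_deriveM De (is_deriveD (is_deriveM Df Dc) (is_deriveM Dk Ds))) _.
    rewrite /= /GRing.scale/= !fctE; ring.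
  apply: is_derive_eq (is_deriveM De (is_deriveB (is_deriveM Dk Dc) (is_deriveM Df Ds))) _.
  rewrite /= /GRing.scale/= !fctE; ring.
have Ab : A b = 1.
  rewrite (is_derive0_cst b0 (fun x xb => (AB x xb).1)) /A p0 q0 f0 k0.
  by rewrite !mulr0 oppr0 expR0 cos0 sin0 mul0r addr0 !mulr1.
have Bb : B b = 0.
  rewrite (is_derive0_cst b0 (fun x xb => (AB x xb).2)) /B p0 q0 f0 k0.
  by rewrite !mulr0 oppr0 expR0 cos0 sin0 mul0r mulr0 subr0 mulr0.
have E : expR (y * p b) * expR (- (y * p b)) = 1 by rewrite expRxMexpNx_1.
set e := expR (y * p b) in E *; set c := cos (y * q b); set s := sin (y * q b).
have cs : c ^+ 2 + s ^+ 2 = 1 by exact: cos2Dsin2.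
have {}Ab : f b * c + k b * s = e.
  by rewrite -[LHS]mul1r -E -mulrA -/(A b) Ab mulr1.
have {}Bb : k b * c - f b * s = 0.
  by rewrite -[LHS]mul1r -E -mulrA -/(B b) Bb mulr0.
have fE : f b = (f b * c + k b * s) * c - (k b * c - f b * s) * s.
  by rewrite -[LHS]mulr1 -cs; ring.
have kE : k b = (f b * c + k b * s) * s + (k b * c - f b * s) * c.
  by rewrite -[LHS]mulr1 -cs; ring.
by split; [rewrite fE Ab Bb mul0r subr0|rewrite kE Ab Bb mul0r addr0].
Qed.

End psum_extra.

(** * The angle as a power series *)

Section lagrange.
Context {R : realType}.
Variable beta : R.
Hypothesis beta01 : 0 < beta < 1.

Local Notation t0 := (critical_value beta).
Let theta := pi * beta.

Let t0_gt0 : 0 < t0 := critical_value_gt0 beta01.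

(* Real and imaginary parts of the coefficients along the ray
   [arg z = theta]. *)
Definition cosc (a : R^nat) n := cos (n%:R * theta) * a n.
Definition sinc (a : R^nat) n := sin (n%:R * theta) * a n.

Lemma radius_ge_cosc rho a : radius_ge rho a -> radius_ge rho (cosc a).
Proof.
move=> ra; apply: (radius_geW ra) => n; rewrite /cosc normrM ler_piMl//.
by rewrite ler_norml cos_geN1 cos_le1.
Qed.

Lemma radius_ge_sinc rho a : radius_ge rho a -> radius_ge rho (sinc a).
Proof.
move=> ra; apply: (radius_geW ra) => n; rewrite /sinc normrM ler_piMl//.
by rewrite ler_norml sin_geN1 sin_le1.
Qed.

(* Coefficients of [L = log B], with [B] as in [rothe]. *)
Definition log_coef n := rothe' beta n 0 / n%:R.

Lemma radius_ge_log_coef : radius_ge t0^-1 log_coef.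
Proof.
apply: (radius_geW (geom_bounded_radius_ge t0_gt0 (rothe'_bounded beta01))) => -[|n].
  by rewrite /log_coef/= mul0r.
by rewrite /log_coef normrM normfV normr_nat ler_piMr// invf_le1// ler1n.
Qed.

Definition logRe := psum (cosc log_coef).
Definition logIm := psum (sinc log_coef).

(** [rothe_rec] shifted by one, its [k = 0] term being zero: formally [(B^y)' = y L' B^y]. *)
Lemma rothe_diffs y n : pseries_diffs (rothe beta ^~ y) n =
  y * conv (pseries_diffs log_coef) (rothe beta ^~ y) n.
Proof.
rewrite /pseries_diffs rothe_rec big_ord_recl mul0r add0r; congr (_ * _).
apply: eq_bigr => i _; rewrite lift0 subSS; congr (_ * _).
by rewrite /log_coef mulrC divfK// pnatr_eq0.
Qed.

(** Differentiation in [b] leaves the phase of [z = b exp(i theta)] alone, so the coefficient [n] of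
    the derivative keeps the angle [(n + 1) theta]. It splits as [(i + 1) theta + (n - i) theta]
    over the Cauchy product, and the addition formula gives the real part of [(B^y)' = y L' B^y];
    the imaginary part follows below in the same way. *)
Lemma diffs_cosc y n : pseries_diffs (cosc (rothe beta ^~ y)) n =
  y * conv (pseries_diffs (cosc log_coef)) (cosc (rothe beta ^~ y)) n +
  - y * conv (pseries_diffs (sinc log_coef)) (sinc (rothe beta ^~ y)) n.
Proof.
rewrite /pseries_diffs /cosc /sinc mulrCA.
rewrite -[X in _ * X]/(pseries_diffs (rothe beta ^~ y) n) rothe_diffs.
rewrite mulrCA mulNr -mulrBr; congr (_ * _).
rewrite mulr_sumr -sumrB; apply: eq_bigr => i _.
have -> : n.+1%:R * theta = i.+1%:R * theta + (n - i)%:R * theta.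
  by rewrite -mulrDl -natrD addSn subnKC// -ltnS.
by rewrite cosD /pseries_diffs; ring.
Qed.

Lemma diffs_sinc y n : pseries_diffs (sinc (rothe beta ^~ y)) n =
  y * conv (pseries_diffs (cosc log_coef)) (sinc (rothe beta ^~ y)) n +
  y * conv (pseries_diffs (sinc log_coef)) (cosc (rothe beta ^~ y)) n.
Proof.
rewrite /pseries_diffs /cosc /sinc mulrCA.
rewrite -[X in _ * X]/(pseries_diffs (rothe beta ^~ y) n) rothe_diffs.
rewrite mulrCA -mulrDr; congr (_ * _).
rewrite mulr_sumr -big_split; apply: eq_bigr => i _.
have -> : n.+1%:R * theta = i.+1%:R * theta + (n - i)%:R * theta.
  by rewrite -mulrDl -natrD addSn subnKC// -ltnS.
by rewrite sinD /pseries_diffs /=; ring.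
Qed.

Lemma psum_conv2 (a b c d : R^nat) (y z x : R) : radius_ge t0^-1 a -> radius_ge t0^-1 b ->
  radius_ge t0^-1 c -> radius_ge t0^-1 d -> `|x| < t0^-1 ->
  psum (fun n => y * conv a b n + z * conv c d n) x =
  y * (psum a x * psum b x) + z * (psum c x * psum d x).
Proof.
move=> ra rb rc rd xrho; apply: cvg_lim => //.
have -> : pseries (fun n => y * conv a b n + z * conv c d n) x =
    (fun n => y * pseries (conv a b) x n + z * pseries (conv c d) x n).
  apply/funext => n; rewrite /pseries /series/= !mulr_sumr -big_split/=.
  by apply: eq_bigr => i _; rewrite mulrDl !mulrA.
by apply: cvgD; apply: (cvgM (cvg_cst _)); apply: cvg_psum_conv xrho.
Qed.

(** The series of [B^y] and [exp(y L)] solve the same linear equation and both equal 1 at [b = 0].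
    This serves for [y = 1] and [y = beta]. *)
Lemma rothe_exp y b : radius_ge t0^-1 (rothe beta ^~ y) -> 0 <= b < t0^-1 ->
  psum (cosc (rothe beta ^~ y)) b = expR (y * logRe b) * cos (y * logIm b) /\
  psum (sinc (rothe beta ^~ y)) b = expR (y * logRe b) * sin (y * logIm b).
Proof.
move=> rg /andP[b0 bt].
have rl := radius_ge_log_coef.
have [rcl rsl] := (radius_ge_cosc rl, radius_ge_sinc rl).
have [rcg rsg] := (radius_ge_cosc rg, radius_ge_sinc rg).
have [dcl dsl] := (radius_ge_diffs rcl, radius_ge_diffs rsl).
apply: (@complex_exp_ode R logRe logIm _ _ (psum (pseries_diffs (cosc log_coef)))
   (psum (pseries_diffs (sinc log_coef)))) => //.
- move=> x /andP[x0 xb]; have xt : `|x| < t0^-1.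
    by rewrite ger0_norm//; exact: le_lt_trans bt.
  split; [exact: is_derive_psum xt|exact: is_derive_psum xt| |].
    apply: is_derive_eq (is_derive_psum rcg xt) _.
    rewrite (funext (diffs_cosc y)) psum_conv2//; ring.
  apply: is_derive_eq (is_derive_psum rsg xt) _.
  rewrite (funext (diffs_sinc y)) psum_conv2//; ring.
- by rewrite /logRe psum0 /cosc /log_coef/= !(mul0r, mulr0).
- by rewrite /logIm psum0 /sinc /log_coef/= !(mul0r, mulr0).
- by rewrite psum0 /cosc mul0r cos0 mul1r.
- by rewrite psum0 /sinc mul0r sin0 mul0r.
Qed.

(* With L = logRe b + i logIm b and z = b exp(i theta), these are the real and
   imaginary parts of exp L = 1 - z exp(beta L). *)
Lemma lagrange_equation b : 0 <= b < t0^-1 ->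
  expR (logRe b) * cos (logIm b) =
    1 - b * expR (beta * logRe b) * cos (theta + beta * logIm b) /\
  expR (logRe b) * sin (logIm b) =
    - (b * expR (beta * logRe b) * sin (theta + beta * logIm b)).
Proof.
move=> bt; have r1 := geom_bounded_radius_ge t0_gt0 (rothe1_bounded beta01).
have rb := geom_bounded_radius_ge t0_gt0 (rothe_beta_bounded beta01).
have [c1 s1] := rothe_exp r1 bt; have [cb sb] := rothe_exp rb bt.
rewrite !mul1r in c1 s1; rewrite -c1 -s1; move: bt => /andP[b0 bt].
have bt' : `|b| < t0^-1 by rewrite ger0_norm.
rewrite (psumS (radius_ge_cosc r1) bt') (psumS (radius_ge_sinc r1) bt').
have [rcb rsb] := (radius_ge_cosc rb, radius_ge_sinc rb).
split.
  have -> : (fun n => cosc (rothe beta ^~ 1) n.+1) = (fun n =>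
      - cos theta * cosc (rothe beta ^~ beta) n +
      sin theta * sinc (rothe beta ^~ beta) n).
    apply/funext => n; rewrite /cosc /sinc rotheS1 -natr1 mulrDl mul1r cosD; ring.
  rewrite (psum_lin _ _ rcb rsb bt') cb sb /cosc mul0r cos0 mul1r cosD /=.
  by ring.
have -> : (fun n => sinc (rothe beta ^~ 1) n.+1) = (fun n =>
    - cos theta * sinc (rothe beta ^~ beta) n +
    - sin theta * cosc (rothe beta ^~ beta) n).
  apply/funext => n; rewrite /cosc /sinc rotheS1 -natr1 mulrDl mul1r sinD; ring.
rewrite (psum_lin _ _ rsb rcb bt') cb sb /sinc mul0r sin0 mul0r sinD /=.
by ring.
Qed.

End lagrange.

(** The factors [x - j] are negative exactly for [j > m]; there are [k - m] of them, with truncated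
    subtraction when [k <= m]. *)
Lemma ffact1_sign (R : realFieldType) (x : R) m k : m%:R <= x < m.+1%:R ->
  0 <= (-1) ^+ (k - m) * ffact1 x k.
Proof.
rewrite -natr1 => /andP[mx xm]; elim: k => [|k IHk].
  by rewrite /ffact1 big_ord0 sub0n expr0 mulr1.
rewrite ffact1S -[k.+1%:R]natr1; have [km|mk] := ltnP k m.
  have -> : (k.+1 - m = k - m)%N by lia.
  have kx : k%:R + 1 <= m%:R :> R by rewrite natr1 ler_nat.
  by rewrite mulrA mulr_ge0//; lra.
have kx : m%:R <= k%:R :> R by rewrite ler_nat.
rewrite subSn// exprS [leRHS](_ : _ =
  ((-1) ^+ (k - m) * ffact1 x k) * (k%:R + 1 - x)); last by ring.
by rewrite mulr_ge0//; lra.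
Qed.

Lemma sin_pi_sign (R : realType) (x : R) m : m%:R <= x < m.+1%:R ->
  0 <= (-1) ^+ m * sin (pi * x).
Proof.
rewrite -natr1 => /andP[mx xm].
have -> : pi * x = pi * (x - m%:R) + m%:R * pi by ring.
have -> : sin (pi * (x - m%:R) + m%:R * pi) = (-1) ^+ m * sin (pi * (x - m%:R)).
  elim: m (pi * _) {mx xm} => [|m IHm] y; first by rewrite mul0r addr0 expr0 mul1r.
  by rewrite -natr1 mulrDl mul1r addrA sinDpi IHm exprS mulN1r mulNr.
have pi0 := pi_gt0 R.
by rewrite mulrA -expr2 sqrr_sign mul1r sin_ge0_pi//; apply/andP; split; nra.
Qed.

(** The derivative [a (cos(a z) - cos z)] is positive because cosine decreases on [[0, pi]]. From
    [x = 0] this bounds [sin u / sin(a u)] by [1 / a]; a general [x] makes the gap uniform in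
    [b_fun_bound]. *)
Lemma ltr_sin_scale (R : realType) (a x y : R) :
  0 < a < 1 -> 0 <= x -> x < y -> y <= pi ->
  sin (a * x) - a * sin x < sin (a * y) - a * sin y.
Proof.
move=> /andP[a0 a1] x0 xy ypi.
pose f z := sin (a * z) - a * sin z.
have df (z : R) : is_derive z (1 : R) f (a * (cos (a * z) - cos z)).
  have Da : is_derive z (1 : R) (fun z => a * z) a.
    by apply: is_derive_eq (is_deriveZ a (is_derive_id z 1)) _; rewrite /GRing.scale/= mulr1.
  apply: is_derive_eq (is_deriveB (is_derive1_comp (is_derive_sin _) Da)
    (is_deriveZ a (is_derive_sin z))) _.
  by rewrite /GRing.scale/=; ring.
have [|c /[!in_itv]/= /andP[xc cy]] := @MVT R f _ x y xy (fun z _ => df z).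
  by apply: derivable_within_continuous => z _; have [] := df z.
rewrite -/(f x) -/(f y) -[f x < _]subr_gt0 => ->.
rewrite mulr_gt0 ?subr_gt0// mulr_gt0// subr_gt0.
have c0 : 0 < c by exact: le_lt_trans xc.
have acc : a * c < c by rewrite gtr_pMl.
have ac0 : 0 < a * c by rewrite mulr_gt0.
by rewrite ltr_cos ?in_itv//= ?(ltW c0) ?(ltW ac0)/=; lra.
Qed.

(** Add the tangent-line bounds of [expR] at the mean [m] with weights [b] and [1 - b]: the linear
    terms cancel. *)
Lemma weighted_amgm_expR (R : realType) (b x y : R) : 0 <= b <= 1 ->
  expR (b * x + (1 - b) * y) <= b * expR x + (1 - b) * expR y.
Proof.
move=> /andP[b0 b1]; have H (m z : R) : expR m * (1 + (z - m)) <= expR z.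
  by rewrite -[in leRHS](subrK m z) expRD mulrC ler_wpM2r ?expR_ge0// expR_ge1Dx.
set m := b * x + (1 - b) * y.
have b1' : 0 <= 1 - b by rewrite subr_ge0.
apply: le_trans (lerD (ler_wpM2l b0 (H m x)) (ler_wpM2l b1' (H m y))).
by rewrite /m; set e := expR _; lra.
Qed.

Section stable_angle.
Context {R : realType}.
Variables alpha beta : R.
Hypothesis alphaE : 1 - alpha = beta.
Hypothesis beta01 : 0 < beta < 1.

Local Notation t0 := (critical_value beta).
Let t0_gt0 : 0 < t0 := critical_value_gt0 beta01.

Definition angle_coef n : R := - sinc beta (log_coef beta) n.

(* With [m = floor (beta * n)], the factor [sin (pi * beta * n)] has the sign of
   [(-1) ^+ m] and [n - 1 - m] factors of [ffact1] are negative. *)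
Lemma angle_coef_ge0 n : 0 <= angle_coef n.
Proof.
move: beta01 => /andP[b0 b1].
rewrite /angle_coef /sinc /log_coef oppr_ge0; case: n => [|n].
  by rewrite /= !(mul0r, mulr0).
set c := sin _; rewrite /rothe' add0r.
have [m xm] : exists m, m%:R <= beta * n.+1%:R < m.+1%:R.
  exists (Num.truncn (beta * n.+1%:R)).
  by apply: Num.Theory.truncn_itv; rewrite mulr_ge0// ltW.
have mn : (m <= n)%N.
  rewrite -ltnS -(ltr_nat R); move: xm => /andP[mx _]; apply: le_lt_trans mx _.
  by rewrite gtr_pMl.
rewrite -oppr_ge0.
have -> : - (c * ((-1) ^+ n.+1 * ffact1 (beta * n.+1%:R) n / n`!%:R / n.+1%:R)) =
  ((-1) ^+ m * sin (pi * (beta * n.+1%:R))) *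
  ((-1) ^+ (n - m) * ffact1 (beta * n.+1%:R) n) * (n`!%:R^-1 / n.+1%:R).
  have -> : c = sin (pi * (beta * n.+1%:R)) by rewrite /c; congr sin; ring.
  have -> : (-1) ^+ n.+1 = - ((-1) ^+ m * (-1) ^+ (n - m)) :> R.
    by rewrite -exprD subnKC// exprS mulN1r.
  by ring.
by rewrite mulr_ge0 ?divr_ge0// mulr_ge0 ?(ffact1_sign _ xm) ?sin_pi_sign.
Qed.

Lemma angle_coef1_gt0 : 0 < angle_coef 1.
Proof.
rewrite /angle_coef /sinc /log_coef /rothe' /ffact1 big_ord0 fact0.
rewrite !(mulr1, mul1r, invr1) expr1 mulrN1 opprK.
have pi0 := pi_gt0 R.
by rewrite sin_gt0_pi//; move: beta01 => /andP[? ?]; apply/andP; split; nra.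
Qed.

Let rs := radius_ge_sinc beta (radius_ge_log_coef beta01).

Lemma radius_ge_angle_coef : radius_ge t0^-1 angle_coef.
Proof. by apply: (radius_geW rs) => n; rewrite normrN. Qed.
Let ra := radius_ge_angle_coef.

Definition angle := psum angle_coef.

Lemma angleE b : `|b| < t0^-1 -> logIm beta b = - angle b.
Proof.
move=> bt; rewrite /angle (_ : angle_coef = fun n =>
    (-1) * sinc beta (log_coef beta) n + 0 * sinc beta (log_coef beta) n).
  by rewrite (psum_lin _ _ rs rs bt) mul0r addr0 mulN1r opprK.
by apply/funext => n; rewrite mul0r addr0 mulN1r.
Qed.

(** The series are compared term by term, keeping the term [n = 1]: mere strictness would be lost in
    the limit of the partial sums. *)
Lemma angle_le (x y : R) : 0 <= x -> x <= y -> y < t0^-1 ->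
  angle_coef 1 * (y - x) <= angle y - angle x.
Proof.
move=> x0 xy yt; have y0 := le_trans x0 xy.
have ry : `|y| < t0^-1 by rewrite ger0_norm.
have rx : `|x| < t0^-1 by rewrite ger0_norm// (le_lt_trans xy).
have cy := radius_ge_cvg_pseries ra ry; have cx := radius_ge_cvg_pseries ra rx.
rewrite -limB//; apply: limr_ge; first exact: is_cvgB.
near=> n.
rewrite !fctE /pseries /series/= -sumrB.
rewrite -(subnKC (_ : 2 <= n)%N); last by near: n; exists 2%N.
rewrite addSn add1n big_nat_recl// big_nat_recl//= expr0 !mulr1 subrr add0r !expr1 -mulrBr lerDl.
apply: sumr_ge0 => i _; rewrite -mulrBr mulr_ge0 ?angle_coef_ge0// subr_ge0.
by rewrite lerXn2r.
Unshelve. all: by end_near. Qed.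

Lemma angle_lt (x y : R) : 0 <= x -> x < y -> y < t0^-1 -> angle x < angle y.
Proof.
move=> x0 xy yt; rewrite -subr_gt0; apply: lt_le_trans (angle_le x0 (ltW xy) yt).
by rewrite mulr_gt0 ?angle_coef1_gt0// subr_gt0.
Qed.

Lemma angle0 : angle 0 = 0.
Proof. by rewrite /angle psum0 /angle_coef /sinc /= !mul0r sin0 mul0r oppr0. Qed.

(* The triangle of angles [alpha * u], [beta * u] and [pi - u], with side
   [expR p] opposite to [beta * u] when the side opposite to [alpha * u] is 1. *)
Lemma triangle_equations b : 0 <= b < t0^-1 -> let u := pi - angle b in
  let p := logRe beta b in
  expR p * cos u = b * expR (beta * p) * cos (beta * u) - 1 /\
  expR p * sin u = b * expR (beta * p) * sin (beta * u).
Proof.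
move=> b01; have [] := lagrange_equation beta01 b01.
rewrite angleE ?ger0_norm; try by move: b01 => /andP[].
rewrite cosN sinN => E1 E2 u p.
have -> : beta * u = pi * beta + beta * - angle b by rewrite /u; ring.
rewrite /u addrC cosDpi sinDpi cosN sinN opprK; split.
  by rewrite mulrN E1; ring.
by rewrite -[LHS]opprK -mulrN E2 opprK.
Qed.

(* An angle [pi] would give [b = expR (- beta * p) + expR (alpha * p)], which is
   at least [t0^-1] by the weighted AM-GM inequality. *)
Lemma angle_neq_pi b : 0 <= b < t0^-1 -> angle b != pi.
Proof.
move=> b01; apply/eqP => bpi; move: (b01) => /andP[b0]; rewrite ltNge => /negP; apply.
have [] := triangle_equations b01; rewrite bpi subrr mulr0 cos0 !mulr1 => E _.
set p := logRe beta b in E.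
move: beta01 => /andP[beta0 beta1].
have b01' : 0 <= beta <= 1 by rewrite !ltW.
(* The logarithmic shifts turn the right side into [expR p + 1], which is [b * expR (beta * p)] by
   [E], and the left side into [expR (beta * p) / t0]. *)
have := weighted_amgm_expR (p - ln beta) (- ln (1 - beta)) b01'.
rewrite !expRD !expRN !lnK ?posrE ?subr_gt0//.
have -> : beta * (expR p / beta) = expR p by field; rewrite gt_eqF.
rewrite divff ?subr_eq0 ?gt_eqF//.
have -> : expR (beta * (p - ln beta)) = expR (beta * p) / beta `^ beta.
  by rewrite /powR gt_eqF// -expRN -expRD; congr expR; ring.
have -> : expR ((1 - beta) * - ln (1 - beta)) = ((1 - beta) `^ (1 - beta))^-1.
  by rewrite /powR gt_eqF ?subr_gt0// -expRN; congr expR; ring.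
rewrite E subrK -mulrA -invfM -/(critical_value beta) mulrC.
by rewrite ler_pM2r ?expR_gt0.
Qed.

(** [angle] is continuous, starts at 0 and never takes the value [pi]. *)
Lemma angle_lt_pi b : 0 <= b < t0^-1 -> angle b < pi.
Proof.
move=> /andP[b0 bt]; rewrite ltNge; apply/negP => pia.
have [||c] := @IVT R angle 0 b pi b0.
- apply: derivable_within_continuous => x; rewrite in_itv/= => /andP[x0 xb].
  have xt : `|x| < t0^-1 by rewrite ger0_norm// (le_lt_trans xb).
  by have [] := is_derive_psum ra xt.
- by rewrite angle0 minEle maxEle (le_trans (pi_ge0 R) pia) pi_ge0.
- rewrite in_itv/= => /andP[c0 cb] /eqP; apply/negP/angle_neq_pi.
  by rewrite c0 (le_lt_trans cb).
Qed.

(** By the law of sines in the triangle, [expR p] is [sin (beta * u) / sin (alpha * u)], and the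
    second triangle equation gives [b = expR (alpha * p) * (sin u / sin (beta * u))]; eliminate
    [p]. *)
Lemma b_fun_angle b : 0 < b < t0^-1 -> b_fun alpha (pi - angle b) = b.
Proof.
move=> /andP[b0 bt]; have b01 : 0 <= b < t0^-1 by rewrite ltW.
have [] := triangle_equations b01; set u := pi - angle b; set p := logRe beta b.
have u0 : 0 < u by rewrite subr_gt0 angle_lt_pi.
have upi : u < pi by rewrite ltrBlDr ltrDl -angle0 angle_lt.
clearbody u p; move: beta01 => /andP[beta0 beta1] E1 E2.
have [alpha0 alpha1] : 0 < alpha /\ alpha < 1 by move: beta0 beta1; rewrite -alphaE; split; lra.
have s0 : 0 < sin u by rewrite sin_gt0_pi ?u0.
have sin_pos g : 0 < g -> g < 1 -> 0 < sin (g * u).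
  move=> g0 g1; rewrite sin_gt0_pi// mulr_gt0//= (lt_trans _ upi)//.
  by rewrite gtr_pMl.
have [sa0 sb0] := (sin_pos _ alpha0 alpha1, sin_pos _ beta0 beta1).
have E3 : sin (beta * u) = expR p * sin (alpha * u).
  have -> : alpha * u = u - beta * u by rewrite -alphaE; ring.
  by rewrite sinB mulrBr !mulrA E1 E2; ring.
have E : 0 < expR p by exact: expR_gt0.
have -> : b = expR (alpha * p) * (sin u / sin (beta * u)).
  have -> : alpha * p = p - beta * p by rewrite -alphaE; ring.
  rewrite expRD expRN mulrACA E2; have := expR_gt0 (beta * p); set F := expR _ => F0.
  by field; rewrite !gt_eqF.
rewrite /b_fun alphaE.
have -> : sin u / sin (alpha * u) = expR p * (sin u / sin (beta * u)).
  by rewrite E3; field; rewrite !gt_eqF.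
set r := sin u / _; have r0 : 0 < r by rewrite divr_gt0.
rewrite powRM ?(ltW E) ?(ltW r0)// -mulrA -powRD; last by rewrite (gt_eqF r0) implybT.
rewrite -alphaE addrC subrK powRr1 ?(ltW r0)// mulrC [expR p `^ _]/powR gt_eqF// expRK.
by rewrite mulrC.
Qed.

(** The value [t0^-1] is approached only as [u] tends to 0. Past [u0], the gap [e] persists by
    [ltr_sin_scale]; with [sin u <= 1] it improves the bound [1 / alpha] on the first quotient to
    [1 / (alpha + e)], uniformly up to [pi]. *)
Lemma b_fun_bound u0 : 0 < u0 < pi -> exists2 M, 0 < M < t0^-1 &
  forall u, u0 <= u < pi -> 0 < b_fun alpha u <= M.
Proof.
move=> /andP[u00 u0pi]; move: (beta01) => /andP[beta0 beta1].
have [alpha0 alpha1] : 0 < alpha /\ alpha < 1.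
  by move: beta0 beta1; rewrite -alphaE; split; lra.
have a01 : 0 < alpha < 1 by rewrite alpha0.
have [e e0 eE] : exists2 e, 0 < e & e = sin (alpha * u0) - alpha * sin u0.
  eexists; last reflexivity.
  have := ltr_sin_scale a01 (lexx 0) u00 (ltW u0pi).
  by rewrite !mulr0 sin0 mulr0 subr0.
have X0 : 0 < (alpha + e) `^ alpha by rewrite powR_gt0 ?addr_gt0.
have Y0 : 0 < beta `^ beta by rewrite powR_gt0.
exists ((alpha + e) `^ alpha * beta `^ beta)^-1.
  have XY0 : 0 < (alpha + e) `^ alpha * beta `^ beta by rewrite mulr_gt0.
  rewrite invr_gt0 XY0/= ltf_pV2 ?posrE//.
  rewrite /critical_value mulrC -alphaE subKr ltr_pM2r ?alphaE//.
  by rewrite gt0_ltr_powR ?nnegrE ?addr_ge0 ?(ltW alpha0) ?(ltW e0)// ltrDl.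
move=> u /andP[u0u upi]; have u_gt0 : 0 < u by exact: lt_le_trans u0u.
have sin_pos g : 0 < g -> g < 1 -> 0 < sin (g * u).
  move=> g0 g1; rewrite sin_gt0_pi// mulr_gt0//= (lt_trans _ upi)//.
  by rewrite gtr_pMl.
have [sa0 sb0] := (sin_pos _ alpha0 alpha1, sin_pos _ beta0 beta1).
have s0 : 0 < sin u by rewrite sin_gt0_pi ?u_gt0.
have [ra0 rb0] := (divr_gt0 s0 sa0, divr_gt0 s0 sb0).
rewrite /b_fun alphaE mulr_gt0 ?powR_gt0//= invfM.
have powVr (x a : R) : 0 < x -> (x `^ a)^-1 = x^-1 `^ a.
  by move=> x0; rewrite -powRN -mulN1r powRrM powR_inv1 ?(ltW x0).
rewrite !powVr ?addr_gt0//.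
apply: ler_pM; rewrite ?powR_ge0//; apply: ge0_ler_powR;
  rewrite ?nnegrE ?invr_ge0 ?addr_ge0 ?(ltW alpha0) ?(ltW beta0) ?(ltW e0) ?(ltW ra0) ?(ltW rb0)//.
  rewrite ler_pdivrMr// mulrC ler_pdivlMr ?addr_gt0//.
  have e_le : e <= sin (alpha * u) - alpha * sin u.
    rewrite eE.
    move: u0u; rewrite le_eqVlt => /predU1P[<-//|u0u].
    exact: ltW (ltr_sin_scale a01 (ltW u00) u0u (ltW upi)).
  have : sin u * e <= e by rewrite ler_piMl ?sin_le1// ltW.
  by rewrite mulrDr; lra.
rewrite ler_pdivrMr// mulrC ler_pdivlMr// mulrC.
have := ltr_sin_scale beta01 (lexx 0) u_gt0 (ltW upi).
by rewrite !mulr0 sin0 mulr0 subr0 subr_gt0 => /ltW.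
Qed.

(** [b_fun_angle] alone does not show that every [u] has the form [pi - angle c]. If [angle] stayed
    below [pi - u], then for some [b > M] the point [pi - angle b] would lie in [[u, pi[] and
    [b_fun alpha] would take the value [b] there, against [b_fun_bound]. The intermediate value
    theorem then yields [c]. *)
Lemma angle_b_fun u : 0 < u < pi ->
  0 < b_fun alpha u < t0^-1 /\ angle (b_fun alpha u) = pi - u.
Proof.
move=> /andP[u0 upi]; have [|M /andP[M0 Mt] bM] := b_fun_bound (u0 := u).
  by rewrite u0.
pose b := (M + t0^-1) / 2; have [Mb bt] := midf_lt Mt; rewrite -/b in Mb bt.
have b0 : 0 < b by exact: lt_trans Mb.
have bu : pi - u <= angle b.
  rewrite leNgt; apply/negP => ub.
  have : u <= pi - angle b < pi.
    by rewrite lerBrDr -lerBrDl ltW//= ltrBlDr ltrDl -angle0 angle_lt.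
  by move=> /bM; rewrite b_fun_angle ?b0// => /andP[_]; rewrite leNgt Mb.
have [||c] := @IVT R angle 0 b (pi - u) (ltW b0).
- apply: derivable_within_continuous => x; rewrite in_itv/= => /andP[x0 xb].
  have xt : `|x| < t0^-1 by rewrite ger0_norm// (le_lt_trans xb).
  by have [] := is_derive_psum ra xt.
- have pu0 : 0 <= pi - u by rewrite subr_ge0 ltW.
  by rewrite angle0 minEle maxEle (le_trans pu0 bu) pu0.
- rewrite in_itv/= => /andP[c0 cb] cu.
  have {}c0 : 0 < c.
    rewrite lt_neqAle c0 andbT; apply/eqP => c0'.
    by move: cu; rewrite -c0' angle0; lra.
  have ct : c < t0^-1 by exact: le_lt_trans bt.
  have <- : c = b_fun alpha u by rewrite -[LHS]b_fun_angle ?c0// cu subKr.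
  by rewrite c0.
Qed.

End stable_angle.

(** * Mixtures of Gamma laws *)

Section density.
Context d (T : measurableType d) (R : realType).
Variables (mu : {measure set T -> \bar R}) (phi : T -> R).
Hypotheses (mphi : measurable_fun setT phi) (phi_ge0 : forall x, 0 <= phi x).

(* The hypotheses are arguments of [mdensity] so that its measure structure can
   be inferred. *)
Definition mdensity of measurable_fun setT phi & (forall x, 0 <= phi x) :=
  fun A : set T => (\int[mu]_(x in A) (phi x)%:E)%E.

Local Notation dens := (mdensity mphi phi_ge0).

Let dens0 : dens set0 = 0%E.
Proof. by rewrite /mdensity integral_set0. Qed.

Let dens_ge0 A : (0 <= dens A)%E.
Proof. by apply: integral_ge0 => x _; rewrite lee_fin. Qed.

Let dens_sigma_additive : semi_sigma_additive dens.
Proof.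
move=> /= F mF tF mUF; rewrite /mdensity; apply: cvg_toP.
  apply: ereal_nondecreasing_is_cvgn => m n mn.
  by apply: lee_sum_nneg_natr => // k _ _; apply: integral_ge0 => /= x _; rewrite lee_fin.
rewrite ge0_integral_bigcup//=; last by move=> x _; rewrite lee_fin.
exact/measurable_funTS/measurableT_comp.
Qed.

HB.instance Definition _ := isMeasure.Build _ _ _
  dens dens0 dens_ge0 dens_sigma_additive.

Import HBNNSimple.
Local Open Scope ereal_scope.

Let integral_density_nnsfun (f : {nnsfun T >-> R}) :
  \int[dens]_x (f x)%:E = \int[mu]_x ((f x)%:E * (phi x)%:E).
Proof.
under [LHS]eq_integral do rewrite fimfunE -fsumEFin//.
rewrite [LHS]ge0_integral_fsum//; last 2 first.
  - by move=> r; exact/measurable_EFinP/measurableT_comp.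
  - by move=> n x _; rewrite EFinM nnfun_muleindic_ge0.
under [RHS]eq_integral.
  move=> x _; rewrite fimfunE -fsumEFin// muleC ge0_mule_fsumr; last first.
    by move=> r; rewrite EFinM nnfun_muleindic_ge0.
  over.
rewrite [RHS]ge0_integral_fsum//; last 2 first.
  - move=> r; apply/measurable_EFinP; apply: measurable_funM => //.
    exact: measurableT_comp.
  - by move=> n x _; rewrite EFinM mule_ge0 ?nnfun_muleindic_ge0 ?lee_fin.
apply: eq_fsbigr => r _.
have mr : measurable (f @^-1` [set r]) by [].
rewrite integralZl_indic_nnsfun//= integral_indic//= setIT.
under [RHS]eq_integral do rewrite EFinM muleCA.
have [r0|r0] := leP 0%R r; last first.
  rewrite preimage_nnfun0// measure0 mule0 integral0_eq// => x _.
  by rewrite indicE in_set0 mule0 mule0.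
rewrite ge0_integralZl//; last 2 first.
  - apply: emeasurable_funM; first exact: measurableT_comp.
    exact: measurableT_comp.
  - by move=> x _; rewrite mule_ge0// lee_fin.
congr (_ * _); rewrite /mdensity [LHS]integral_mkcond; apply: eq_integral => x _.
by rewrite patchE indicE; case: ifPn => _; rewrite ?mule1 ?mule0.
Qed.

Lemma integral_density (f : T -> \bar R) : measurable_fun setT f ->
  (forall x, 0 <= f x) -> \int[dens]_x f x = \int[mu]_x (f x * (phi x)%:E).
Proof.
move=> mf f0.
pose f_ := nnsfun_approx measurableT mf.
transitivity (limn (fun n => \int[dens]_x (f_ n x)%:E)).
  rewrite -monotone_convergence//=.
  - by apply: eq_integral => ? _; apply/esym/cvg_lim => //=; exact: cvg_nnsfun_approx.
  - by move=> n; exact/measurable_EFinP/measurable_funTS.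
  - by move=> n ? _; rewrite lee_fin.
  - by move=> ? _ ? ? mn; rewrite lee_fin; exact/lefP/nd_nnsfun_approx.
rewrite (_ : (fun n => _) = (fun n => \int[mu]_x ((f_ n x)%:E * (phi x)%:E))); last first.
  by apply/funext => n; exact: integral_density_nnsfun.
rewrite -monotone_convergence//=.
- apply: eq_integral => x _; apply/cvg_lim => //=.
  by apply: cvgeZr => //; exact: cvg_nnsfun_approx.
- move=> n; apply: emeasurable_funM; last exact: measurableT_comp.
  exact/measurable_EFinP/measurable_funTS.
- by move=> n x _; rewrite mule_ge0// lee_fin.
- move=> x _ m n mn; rewrite lee_wpmul2r ?lee_fin//.
  exact/lefP/nd_nnsfun_approx.
Qed.

End density.

Section stretched_exponential.
Context {R : realType}.
Notation mu := (@lebesgue_measure R).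

(** The substitution [t = h^(1/k)] turns its integral over the half-line into
    [Gamma(k + 1) a^(-k)]. *)
Definition stretched_exp (k a h : R) := expR (- (a * h `^ k^-1)).

Lemma measurable_stretched_exp k a : measurable_fun setT (stretched_exp k a).
Proof.
apply: measurableT_comp => //; apply: measurableT_comp => //.
by apply: measurable_funM => //; exact: measurable_powR.
Qed.

Lemma stretched_exp_gt0 k a h : 0 < stretched_exp k a h.
Proof. exact: expR_gt0. Qed.

Lemma continuous_stretched_exp k a : 0 < k ->
  {within `[0, +oo[, continuous (stretched_exp k a)}.
Proof.
move=> k0; apply/continuous_within_itvcyP; split.
  move=> x; rewrite in_itv/= andbT => x0.
  apply: continuous_comp; last exact: continuous_expR.
  apply: cvgN; apply: cvgM; first exact: cvg_cst.
  suff : {for x, continuous (fun h : R => h `^ k^-1)} by [].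
  apply: differentiable_continuous; apply/derivable1_diffP.
  by apply: derivable_powR; rewrite in_itv/= andbT.
rewrite /stretched_exp; apply: (@cvg_comp _ _ _ _ _ _ (nbhs (- (a * 0 `^ k^-1)))); last first.
  exact: continuous_expR.
apply: cvgN; apply: cvgM; first exact: cvg_cst.
by rewrite powR0 ?invr_eq0 ?gt_eqF//; apply: powR_cvg0; rewrite invr_gt0.
Qed.

(** With [y = h^(1/k)] and [2 k <= N + 1], one has [h^2 = y^(2k) <= 1 + y^(N+1) <= 1 + (N+1)!
    exp(y)]. Hence the integrand is dominated by [C / (1 + h^2)], whose primitive is [C atan]. *)
Lemma integral_stretched_exp_lty k : 0 < k ->
  (\int[mu]_(h in `[0%R, +oo[) (stretched_exp k 1 h)%:E < +oo)%E.
Proof.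
move=> k0; have [N kN] : exists N, 2 * k <= N.+1%:R.
  exists (Num.truncn (2 * k)); rewrite ltW//.
  by have /andP[] := @Num.Theory.truncn_itv R (2 * k) (ltW (mulr_gt0 (ltr0Sn R 1) k0)).
pose C : R := 2 + (N.+1)`!%:R.
have bound (h : R) : 0 <= h -> stretched_exp k 1 h <= C * (oneDsqr h)^-1.
  move=> h0; rewrite ler_pdivlMr ?(lt_le_trans _ (oneDsqr_ge1 h))//.
  rewrite /stretched_exp mul1r expRN mulrC ler_pdivrMr ?expR_gt0//.
  set y := h `^ k^-1; have y0 : 0 <= y by exact: powR_ge0.
  have hE : h ^+ 2 = y `^ (2 * k).
    by rewrite -powRrM mulrC -mulrA divff ?gt_eqF// mulr1 powR_mulrn.
  have yN : y `^ (2 * k) <= 1 + y ^+ N.+1.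
    have [y1|y1] := leP y 1.
      apply: (@le_trans _ _ (1 `^ (2 * k))); last by rewrite powR1 lerDl exprn_ge0.
      by apply: ge0_ler_powR; rewrite ?nnegrE// mulr_ge0// ltW.
    rewrite ler_wpDl// -powR_mulrn// ler_powR// ltW//.
  have ye : y ^+ N.+1 <= (N.+1)`!%:R * expR y.
    have := expR_ge1Dxn N y0; rewrite -ler_pdivrMl ?ltr0n ?fact_gt0//.
    by rewrite mulrC; apply: le_trans; rewrite lerDr.
  have e1 : 1 <= expR y by rewrite -expR0 ler_expR.
  rewrite /oneDsqr hE /C [leRHS]mulrDl; lra.
have mi : measurable_fun setT (fun h : R => C%:E * ((oneDsqr h)^-1)%:E)%E.
  apply: emeasurable_funM; first exact: measurable_cst.
  apply: measurableT_comp => //.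
  by apply: continuous_measurable_fun; exact: continuous_oneDsqrV.
apply: le_lt_trans (_ : (\int[mu]_(h in `[0%R, +oo[) (C%:E * ((oneDsqr h)^-1)%:E) < +oo)%E).
  apply: ge0_le_integral => //.
  - by move=> h _; rewrite lee_fin ltW// stretched_exp_gt0.
  - by apply: measurable_funTS; apply: measurableT_comp => //; exact: measurable_stretched_exp.
  - exact: measurable_funTS mi.
  - by move=> h; rewrite /= in_itv/= andbT => h0; rewrite -EFinM lee_fin bound.
have C0 : 0 <= C by rewrite addr_ge0.
have V0 (h : R) : 0 <= (oneDsqr h)^-1 by rewrite invr_ge0 (le_trans _ (oneDsqr_ge1 h)).
rewrite ge0_integralZl//; last first.
  apply: measurable_funTS; apply: measurableT_comp => //.
  by apply: continuous_measurable_fun; exact: continuous_oneDsqrV.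
rewrite (@ge0_continuous_FTC2y _ _ atan 0 (pi / 2)) ?ltry//.
- by apply: continuous_subspaceT; exact: continuous_oneDsqrV.
- exact: cvgy_atan.
- by apply: cvg_at_right_filter; exact: continuous_atan.
- by move=> x _; rewrite derive1E; have [_ ->] := is_derive1_atan x.
Qed.

Lemma integral_stretched_exp_gt0 k : 0 < k ->
  (0 < \int[mu]_(h in `[0%R, +oo[) (stretched_exp k 1 h)%:E)%E.
Proof.
move=> k0.
apply: lt_le_trans (_ : (\int[mu]_(h in `[0%R, 1%R]) (expR (- 1))%:E <= _)%E).
  by rewrite integral_cst//= lebesgue_measure_itv/= lte01 oppr0 adde0 mule1 lte_fin expR_gt0.
apply: le_trans (_ : (\int[mu]_(h in `[0%R, 1%R]) (stretched_exp k 1 h)%:E <= _)%E).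
  apply: ge0_le_integral => //.
  - by apply: measurable_funTS; apply: measurableT_comp => //; exact: measurable_stretched_exp.
  - move=> h; rewrite /= in_itv/= => /andP[h0 h1].
    rewrite lee_fin ler_expR mul1r lerN2.
    apply: (@le_trans _ _ (1 `^ k^-1)); last by rewrite powR1.
    by apply: ge0_ler_powR; rewrite ?nnegrE// invr_ge0 ltW.
apply: ge0_subset_integral => //.
- by apply: measurable_funTS; apply: measurableT_comp => //; exact: measurable_stretched_exp.
- by move=> h _; rewrite lee_fin ltW// expR_gt0.
- by move=> h; rewrite /= !in_itv/= andbT => /andP[].
Qed.

Lemma integral_stretched_exp_scale k a : 0 < k -> 0 < a ->
  (\int[mu]_(h in `[0%R, +oo[) (stretched_exp k a h)%:E =
   (a `^ (- k))%:E * \int[mu]_(h in `[0%R, +oo[) (stretched_exp k 1 h)%:E)%E.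
Proof.
(* The scale [q] satisfies [(q h)^(1/k) = a h^(1/k)] for [h >= 0]. *)
move=> k0 a0; pose q := a `^ k; have q0 : 0 < q by exact: powR_gt0.
have dq (x : R) : is_derive x (1 : R) (fun h => q * h) q.
  by apply: is_derive_eq (is_deriveZ q (is_derive_id x 1)) _; rewrite /GRing.scale/= mulr1.
have Dq : (fun h : R => q * h)^`()%classic = cst q.
  by apply/funext => x; rewrite derive1E; exact: derive_val.
have := @increasing_ge0_integration_by_substitutiony R (fun h => q * h) (stretched_exp k 1) 0.
rewrite Dq mulr0 => -> //; last 7 first.
- by move=> x _; exact: cst_continuous.
- exact: is_cvg_cst.
- exact: is_cvg_cst.
- split; first by move=> x _; have [] := dq x.
  by apply: cvg_at_right_filter; apply: cvgM; [exact: cvg_cst|exact: cvg_id].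
- exact: gt0_cvgMry.
- exact: continuous_stretched_exp.
- by move=> x _; rewrite ltW// stretched_exp_gt0.
- under [in RHS]eq_integral.
    move=> x; rewrite inE/= in_itv/= andbT => x0.
    rewrite [X in X%:E](_ : _ = q * stretched_exp k a x); last first.
      transitivity (stretched_exp k 1 (q * x) * q); first by [].
      rewrite mulrC /stretched_exp mul1r powRM ?(ltW q0)// /q -powRrM.
      by rewrite divff ?gt_eqF// powRr1// ltW.
    rewrite EFinM; over.
  rewrite ge0_integralZl//.
  + by rewrite muleA -EFinM /q powRN mulVf ?mul1e// gt_eqF// powR_gt0.
  + by apply: measurable_funTS; apply: measurableT_comp => //; exact: measurable_stretched_exp.
  + by move=> x _; rewrite lee_fin ltW// stretched_exp_gt0.
  + by rewrite lee_fin ltW.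
- by move=> x y _ _ xy; rewrite ltr_pM2l.
Qed.

End stretched_exponential.

Section log_gamma_mixture.
Context {R : realType}.
Notation mu := (@lebesgue_measure R).
Variables (w k : nat -> R).
Hypotheses (w_ge0 : forall n, 0 <= w n) (k_gt0 : forall n, 0 < k n).
Hypothesis w_sum1 : (\sum_(n <oo) (w n)%:E = 1)%E.

Definition stretched_mass n : R :=
  fine (\int[mu]_(h in `[0%R, +oo[) (stretched_exp (k n) 1 h)%:E)%E.

Lemma stretched_massE n : (\int[mu]_(h in `[0%R, +oo[)
  (stretched_exp (k n) 1 h)%:E = (stretched_mass n)%:E)%E.
Proof.
rewrite /stretched_mass fineK// ge0_fin_numE.
  exact: integral_stretched_exp_lty.
exact/ltW/integral_stretched_exp_gt0.
Qed.

Lemma stretched_mass_gt0 n : 0 < stretched_mass n.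
Proof. by rewrite -lte_fin -stretched_massE; exact: integral_stretched_exp_gt0. Qed.

Definition stretched_pdf n (h : R) : R :=
  (w n / stretched_mass n) * (\1_(`]0%R, +oo[ : set R) h * stretched_exp (k n) 1 h).

Lemma measurable_stretched_pdf n : measurable_fun setT (stretched_pdf n).
Proof.
apply: measurable_funM => //; apply: measurable_funM; last exact: measurable_stretched_exp.
exact: measurable_indic.
Qed.

Lemma stretched_pdf_ge0 n h : 0 <= stretched_pdf n h.
Proof.
by rewrite mulr_ge0 ?divr_ge0 ?(ltW (stretched_mass_gt0 n))// mulr_ge0// ltW// stretched_exp_gt0.
Qed.

(* If [H] has density proportional to [exp (- h `^ (k n)^-1)] on the positive
   reals, then [H `^ (k n)^-1] has the Gamma law of parameter [k n]; this avoids
   the singularity at 0 of the Gamma density. *)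
Definition log_root n (h : R) : R := (k n)^-1 * ln h.

Lemma measurable_log_root n : measurable_fun setT (log_root n).
Proof. by apply: measurable_funM => //; exact: measurable_ln. Qed.

(** The law of the logarithm of the Gamma rate, with total mass [w n]. The logarithm lets the
    mixture live on the whole line, so that the factor [c * expR (- t)] is positive at every point,
    as [mixture_of_exponentials] demands. *)
Definition log_gamma (n : nat) : {measure set R -> \bar R}.
Proof.
unshelve refine (pushforward (mdensity mu (@measurable_stretched_pdf n)
  (@stretched_pdf_ge0 n)) (log_root n) : {measure set R -> \bar R}).
exact: measurable_log_root.
Defined.

Definition log_gamma_mixture : set R -> \bar R := mseries log_gamma 0.
HB.instance Definition _ := Measure.on log_gamma_mixture.

Local Open Scope ereal_scope.

Lemma integral_log_gamma_mixture (f : R -> \bar R) :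
  measurable_fun setT f -> (forall x, 0 <= f x) ->
  \int[log_gamma_mixture]_x f x =
  \sum_(n <oo) ((w n / stretched_mass n)%:E *
    \int[mu]_(h in `]0%R, +oo[) (f (log_root n h) * (stretched_exp (k n) 1 h)%:E)).
Proof.
move=> mf f0; rewrite ge0_integral_measure_series//; apply: eq_eseriesr => n _.
have mr := measurable_log_root n.
rewrite ge0_integral_pushforward// integral_density; first last.
- by move=> x /=.
- exact: (measurableT_comp mf mr).
have mg : measurable_fun setT (fun h => f (log_root n h) * (stretched_exp (k n) 1 h)%:E).
  apply: emeasurable_funM; first exact: (measurableT_comp mf mr).
  by apply: measurableT_comp => //; exact: measurable_stretched_exp.
rewrite -ge0_integralZl//; first last.
- by rewrite lee_fin divr_ge0// ltW// stretched_mass_gt0.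
- by move=> h _; rewrite mule_ge0// lee_fin ltW// stretched_exp_gt0.
- exact: measurable_funTS mg.
rewrite [RHS]integral_mkcond; apply: eq_integral => h _.
rewrite patchE /stretched_pdf indicE; case: ifPn => _; rewrite ?mul1r ?mul0r ?mulr0 ?mule0//.
by rewrite EFinM muleCA.
Qed.

(** At [t = log_root n h] the integrand times [stretched_exp (k n) 1 h] is
    [stretched_exp (k n) (1 + y) h], and scaling yields the Pareto tail. *)
Lemma laplace_log_gamma_mixture (y : R) : (0 <= y)%R ->
  \int[log_gamma_mixture]_t (expR (- (y * expR t)))%:E =
  \sum_(n <oo) (w n * (1 + y) `^ (- k n))%:E.
Proof.
move=> y0; have y1 : (0 < 1 + y)%R by rewrite ltr_wpDr.
have mf : measurable_fun setT (fun t : R => (expR (- (y * expR t)))%:E).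
  apply: measurableT_comp => //; apply: continuous_measurable_fun => x.
  apply: continuous_comp; last exact: continuous_expR.
  by apply: cvgN; apply: cvgM; [exact: cvg_cst|exact: continuous_expR].
rewrite integral_log_gamma_mixture//.
apply: eq_eseriesr => n _.
have ms : measurable_fun setT (fun h => (stretched_exp (k n) (1 + y) h)%:E).
  by apply: measurableT_comp => //; exact: measurable_stretched_exp.
transitivity ((w n / stretched_mass n)%:E *
    \int[mu]_(h in `]0%R, +oo[) (stretched_exp (k n) (1 + y) h)%:E).
  congr (_ * _); apply: eq_integral => h; rewrite inE/= in_itv/= andbT => h0.
  rewrite -EFinM /stretched_exp -expRD /log_root /powR gt_eqF//.
  by congr (expR _)%:E; ring.
rewrite integral_itv_obnd_cbnd; last exact: measurable_funTS ms.
rewrite integral_stretched_exp_scale// stretched_massE -!EFinM; congr EFin.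
by field; rewrite gt_eqF// stretched_mass_gt0.
Qed.

Let log_gamma_mixtureT : log_gamma_mixture setT = 1.
Proof.
(* The total mass is the transform at [y = 0]. *)
transitivity (\int[log_gamma_mixture]_t (expR (- (0 * expR t)))%:E).
  rewrite -[LHS]mul1e -integral_cst//; apply: eq_integral => t _.
  by rewrite mul0r oppr0 expR0.
rewrite laplace_log_gamma_mixture// -[RHS]w_sum1; apply: eq_eseriesr => n _.
by rewrite addr0 powR1 mulr1.
Qed.

HB.instance Definition _ := Measure_isProbability.Build _ _ R
  log_gamma_mixture log_gamma_mixtureT.

Definition log_gamma_prob : probability R R := log_gamma_mixture.

End log_gamma_mixture.

Lemma exponential_prob1_tail (R : realType) (a : R) : 0 <= a ->
  exponential_prob 1 `]a, +oo[ = (expR (- a))%:E.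
Proof.
move=> a0; rewrite /exponential_prob.
have mpdf : measurable_fun setT (EFin \o exponential_pdf (1 : R)).
  by apply: measurableT_comp => //; exact: measurable_exponential_pdf.
rewrite integral_itv_obnd_cbnd; last exact: measurable_funTS mpdf.
under eq_integral.
  move=> x; rewrite inE/= in_itv/= andbT => ax.
  rewrite exponential_pdfE ?(le_trans a0)// /= mul1r mulN1r; over.
have cexpN : continuous (fun x : R => expR (- x)).
  move=> x; apply: continuous_comp; last exact: continuous_expR.
  exact: continuousN.
have dF (x : R) : is_derive x (1 : R) (fun x => - expR (- x)) (expR (- x)).
  apply: is_derive_eq (is_deriveN (is_derive1_comp (is_derive_expR (- x)) (is_deriveNid x 1))) _.
  by rewrite mulrN1 opprK.
rewrite (@ge0_continuous_FTC2y R (fun x => expR (- x)) (fun x => - expR (- x)) a 0)//.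
- by rewrite EFinN oppeK add0e.
- exact: continuous_subspaceT.
- by rewrite -oppr0; apply: cvgN; exact: cvgr_expR.
- by apply: cvg_at_right_filter; apply: cvgN; exact: cexpN.
- by move=> x _; rewrite derive1E; have [_ ->] := dF x.
Qed.

(** The open right rays form a pi-system generating the Borel sets; on those that start below 0 both
    measures are 1. *)
Lemma eq_probability_tails (R : realType) (m1 m2 : probability R R) :
  (forall x, 0 <= x -> m1 `]x, +oo[%classic = m2 `]x, +oo[%classic) ->
  m1 `]0, +oo[%classic = 1%E -> forall A, measurable A -> m1 A = m2 A.
Proof.
move=> m12 m10 A mA.
have tails x : m1 `]x, +oo[%classic = m2 `]x, +oo[%classic.
  have [x0|x0] := leP 0 x; first exact: m12.
  have tail1 (m : probability R R) :
      m `]0, +oo[%classic = 1%E -> m `]x, +oo[%classic = 1%E.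
    move=> m0; apply/eqP; rewrite eq_le probability_le1//= -m0.
    by rewrite le_measure ?inE// => y /=; rewrite !in_itv/= !andbT; exact: lt_trans.
  by rewrite !tail1// -m12.
apply: (@measure_unique _ R R (@RGenOInfty.G R)
  (fun n => `](- n%:R)%R, +oo[%classic) _ _ _ _ m1 m2) => //.
- exact: RGenOInfty.measurableE.
- move=> _ _ [x ->] [y ->]; exists (Num.max x y).
  apply/seteqP; split => z; rewrite /= !in_itv/= !andbT gt_max; first by case=> -> ->.
  by case/andP.
- by move=> n; exists (- n%:R).
- rewrite -subTset => x _ /=; exists (Num.truncn `|x|).+1 => //=.
  rewrite in_itv/= andbT ltrNl (le_lt_trans _ (Num.Theory.truncnS_gt _))//.
  by rewrite -normrN ler_norm.
- by move=> _ [x ->]; exact: tails.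
- by move=> n; rewrite (le_lt_trans (probability_le1 _ _))// ltry.
Qed.

Definition exponential_prob1 (R : realType) :
  probability (g_sigma_algebraType R.-ocitv.-measurable) R.
Proof. by unshelve refine (exponential_prob 1 : probability _ R). Defined.

Section coordinates.
Context {R : realType}.
Notation RR := (g_sigma_algebraType R.-ocitv.-measurable * R)%type.

Definition exp_factor (z : RR) : R := z.1.

Let measurable_exp_factor : measurable_fun setT exp_factor.
Proof. exact: measurable_fst. Qed.

HB.instance Definition _ := isMeasurableFun.Build _ _ _ _ exp_factor measurable_exp_factor.

Definition scale_factor (c : R) (z : RR) : R := c * expR (- z.2).

Let measurable_scale_factor c : measurable_fun setT (scale_factor c).
Proof.
apply: measurable_funM => //; apply: measurableT_comp => //.
by apply: measurableT_comp => //; exact: measurable_snd.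
Qed.

HB.instance Definition _ c :=
  isMeasurableFun.Build _ _ _ _ (scale_factor c) (measurable_scale_factor c).

End coordinates.

(** Given [t], the product [L * M] is exponential of rate [expR t / c], with tail
    [expR (- (x / c * expR t))]; by Fubini its unconditional tail is the transform of the mixture at
    [x / c]. *)
Lemma mixture_of_exponentials_tails d (T : measurableType d) (R : realType)
    (P : probability T R) (X : {RV P >-> R}) (w k : nat -> R) (c : R) :
  (forall n, 0 <= w n) -> (forall n, 0 < k n) -> 0 < c ->
  (\sum_(n <oo) (w n)%:E = 1)%E ->
  (forall x, 0 <= x -> distribution P X `]x, +oo[ =
    (\sum_(n <oo) (w n * (1 + x / c) `^ (- k n))%:E)%E) ->
  mixture_of_exponentials X.
Proof.
move=> w0 k0 c0 w1 tailX.
pose nu : probability (R) R := log_gamma_prob w0 k0 w1.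
pose Q : probability (g_sigma_algebraType R.-ocitv.-measurable * R)%type R :=
  (exponential_prob1 R \x nu)%E.
pose L : {RV Q >-> R} := exp_factor.
pose M : {RV Q >-> R} := scale_factor c.
have tailLM x : 0 <= x -> distribution Q (L \* M : {RV Q >-> R}) `]x, +oo[ =
    (\sum_(n <oo) (w n * (1 + x / c) `^ (- k n))%:E)%E.
  move=> x0; pose B := (L \* M : {RV Q >-> R}) @^-1` `]x, +oo[%classic.
  have mB : measurable B by rewrite -[B]setTI; apply: measurable_funP.
  transitivity (\int[nu]_t exponential_prob1 R (ysection B t))%E.
    have := indic_fubini_tonelli (exponential_prob1 R) nu mB.
    by rewrite indic_fubini_tonelli_FE// indic_fubini_tonelli_GE.
  rewrite -(laplace_log_gamma_mixture w0 k0) ?divr_ge0 ?(ltW c0)//.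
  apply: eq_integral => t _.
  have -> : ysection B t = `](x / c * expR t)%R, +oo[%classic.
    apply/seteqP; split => l; rewrite /ysection/= inE /B/= !in_itv/= !andbT.
      rewrite /L /M /exp_factor /scale_factor/= => xl.
      by rewrite mulrAC ltr_pdivrMr// -ltr_pdivlMr ?expR_gt0// -expRN -mulrA.
    rewrite mulrAC ltr_pdivrMr// -ltr_pdivlMr ?expR_gt0// -expRN -mulrA.
    by rewrite /L /M /exp_factor /scale_factor.
  by apply: exponential_prob1_tail; rewrite mulr_ge0 ?expR_ge0 ?divr_ge0 ?(ltW c0).
have QX (A B : set R) : measurable A -> measurable B ->
    Q (A `*` B) = (exponential_prob 1 A * nu B)%E.
  by move=> mA mB; exact: (product_measure1E (exponential_prob1 R) nu mA mB).
have eT : exponential_prob 1 [set: R] = 1%E := probability_setT (exponential_prob1 R).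
have nT : nu setT = 1%E := probability_setT nu.
exists _, _, Q, L, M; split.
- move=> A mA; rewrite /distribution /pushforward.
  have -> : L @^-1` A = A `*` setT.
    by apply/seteqP; split => [z /=|z []].
  by rewrite QX// nT mule1.
- by move=> z; rewrite mulr_gt0 ?expR_gt0.
- move=> A B mA mB.
  have mB' : measurable ((fun t : R => c * expR (- t)) @^-1` B).
    rewrite -[_ @^-1` _]setTI; apply: (_ : measurable_fun setT (fun t : R => c * expR (- t))) => //.
    by apply: measurable_funM => //; apply: measurableT_comp => //; exact: measurableT_comp.
  have -> : L @^-1` A = A `*` setT.
    by apply/seteqP; split => [z /=|z []].
  have -> : M @^-1` B = setT `*` ((fun t : R => c * expR (- t)) @^-1` B).
    by apply/seteqP; split => [z /=|z []].
  by rewrite -setXI setTI setIT !QX// nT eT mule1 mul1e.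
- apply: eq_probability_tails => [x x0|].
    exact: etrans (tailX x x0) (esym (tailLM x x0)).
  apply: etrans (tailX 0 (lexx 0)) _; rewrite -[RHS]w1; apply: eq_eseriesr => n _.
  by rewrite mul0r addr0 powR1 mulr1.
Qed.

(** * The law of the angle and the weights of the mixture *)

(** [A] is constrained on []0, pi[] only: elsewhere [b_fun] has no meaning and the uniform law has
    no mass. *)
Lemma uniform_prob_tail (R : realType) (A : set R) (a : R) : measurable A ->
  0 <= a < pi -> A `&` `]0, pi[ = `]a, pi[%classic ->
  uniform_prob (pi_gt0 R) A = ((pi - a) / pi)%:E.
Proof.
move=> mA /andP[a0 api] Aa.
have mI : measurable_fun setT (EFin \o (\1_A : R -> R)).
  by apply/measurable_EFinP; exact: measurable_indic.
have := @integral_uniform R 0 pi (pi_gt0 R) _ mI (fun x => _).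
rewrite integral_indic//= setIT => ->; last by move=> x; rewrite lee_fin.
rewrite integral_itv_bndoo; last exact: measurable_funTS mI.
rewrite integral_indic// Aa.
have mua : lebesgue_measure (`]a, pi[%classic : set R) = (pi - a)%:E.
  by rewrite lebesgue_measure_itv/= lte_fin api -EFinB.
by rewrite [X in (_ * X)%E]mua subr0 -EFinM mulrC.
Qed.

Lemma nneseries_EFin_lim (R : realType) (u : R^nat) : cvgn (series u) ->
  (\sum_(n <oo) (u n)%:E = (limn (series u))%:E)%E.
Proof.
move=> cu; rewrite -EFin_lim//; congr (limn _); apply/funext => n.
by rewrite /series/= sumEFin.
Qed.

Section weights.
Context {R : realType}.
Variables alpha beta : R.
Hypothesis alphaE : 1 - alpha = beta.
Hypothesis beta01 : 0 < beta < 1.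

Local Notation t0 := (critical_value beta).
Let t0_gt0 : 0 < t0 := critical_value_gt0 beta01.

Lemma angle_eseries b : 0 <= b < t0^-1 ->
  (\sum_(n <oo) (angle_coef beta n.+1 * b ^+ n.+1 / pi)%:E =
   (angle beta b / pi)%:E)%E.
Proof.
move=> /andP[b0 bt]; have bt' : `|b| < t0^-1 by rewrite ger0_norm.
have ra := radius_ge_angle_coef beta01.
have rs := radius_ge_shift ra.
have E : (fun n => angle_coef beta n.+1 * b ^+ n.+1 / pi) =
    (b / pi) *: (fun n => angle_coef beta n.+1 * b ^+ n).
  by apply/funext => n; rewrite fctE /GRing.scale/= exprS; ring.
have cs := radius_ge_cvg_pseries rs bt'.
rewrite nneseries_EFin_lim; last by rewrite E; exact: is_cvg_seriesZ.
congr EFin; rewrite E lim_seriesZ//.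
have -> : angle beta b = b * psum (fun n => angle_coef beta n.+1) b.
  by rewrite /angle (psumS ra bt') -(psum0 (angle_coef beta)) -/(angle beta 0) angle0 add0r.
by rewrite /GRing.scale/= mulrAC.
Qed.

(** The index is shifted because the zeroth coefficient is 0; this keeps the exponents
    [n.+1 * (beta / s)] of the mixture positive. *)
Definition weight n := angle_coef beta n.+1 * t0^-1 ^+ n.+1 / pi.

Lemma weight_ge0 n : 0 <= weight n.
Proof.
by rewrite divr_ge0 ?pi_ge0// mulr_ge0 ?angle_coef_ge0// exprn_ge0// invr_ge0 ltW.
Qed.

Lemma angle_psum_le b N : 0 <= b < t0^-1 ->
  \sum_(0 <= n < N) angle_coef beta n.+1 * b ^+ n.+1 <= pi.
Proof.
move=> b01; rewrite -[leRHS]mul1r -ler_pdivrMr ?pi_gt0// -lee_fin mulr_suml -sumEFin.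
have b0 : 0 <= b by case/andP: b01.
apply: le_trans (nneseries_lim_ge (P := xpredT) N _) _.
  by move=> n _ _; rewrite lee_fin divr_ge0 ?pi_ge0// mulr_ge0 ?angle_coef_ge0// exprn_ge0.
rewrite angle_eseries// lee_fin ler_pdivrMr ?pi_gt0// mul1r ltW//.
exact: angle_lt_pi.
Qed.

(** Partial sums at [b < t0^-1] are at most 1, since [angle b < pi]; being polynomials in [b], they
    keep this bound at [t0^-1]. Conversely the weights dominate the series at [b_fun alpha u], which
    sums to [1 - u / pi], and [u] may be arbitrarily small. *)
Lemma weight_sum1 : (\sum_(n <oo) (weight n)%:E = 1)%E.
Proof.
have w0 := weight_ge0; have tV0 : 0 < t0^-1 by rewrite invr_gt0.
apply/eqP; rewrite eq_le; apply/andP; split.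
  apply: lime_le; first by apply: is_cvg_nneseries => n _ _; rewrite lee_fin.
  near=> N; rewrite sumEFin lee_fin -mulr_suml ler_pdivrMr ?pi_gt0// mul1r.
  pose p := \poly_(i < N.+1) angle_coef beta i.
  have a0 : angle_coef beta 0 = 0 by rewrite -(psum0 (angle_coef beta)) -/(angle beta 0) angle0.
  have pE b : p.[b] = \sum_(0 <= n < N) angle_coef beta n.+1 * b ^+ n.+1.
    rewrite /p horner_poly big_ord_recl a0 mul0r add0r big_mkord.
    by apply: eq_bigr => i _; rewrite lift0.
  rewrite -pE; have cp : horner p @ t0^-1^'- --> p.[t0^-1].
    by apply: cvg_at_left_filter; exact: continuous_horner.
  rewrite -(cvg_lim _ cp)//; apply: limr_le; first by apply/cvg_ex; eexists; exact: cp.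
  near=> b; rewrite pE angle_psum_le//; apply/andP; split.
    by near: b; exact: nbhs_left_ge.
  by near: b; exact: nbhs_left_lt.
have lb u : 0 < u < pi -> ((1 - u / pi)%:E <= \sum_(n <oo) (weight n)%:E)%E.
  move=> /(angle_b_fun alphaE beta01)[/andP[b0 bt] bu].
  have -> : 1 - u / pi = angle beta (b_fun alpha u) / pi.
    by rewrite bu mulrBl divff// gt_eqF ?pi_gt0.
  rewrite -angle_eseries ?(ltW b0)//; apply: lee_nneseries => n _.
    by rewrite lee_fin divr_ge0 ?pi_ge0// mulr_ge0 ?angle_coef_ge0// exprn_ge0// ltW.
  rewrite lee_fin ler_wpM2r ?invr_ge0 ?pi_ge0// ler_wpM2l ?angle_coef_ge0//.
  by rewrite lerXn2r ?nnegrE ?ltW.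
apply/lee_addgt0Pr => e e0.
have pi0 := pi_gt0 R.
pose u := Num.min (e * pi) (pi / 2).
have /lb lbu : 0 < u < pi by rewrite /u lt_min gt_min mulr_gt0// divr_gt0//=; lra.
apply: le_trans (leeD2r e%:E lbu); rewrite -EFinD lee_fin.
have : u / pi <= e by rewrite ler_pdivrMr// /u ge_min lexx.
by lra.
Unshelve. all: by end_near. Qed.

End weights.

Theorem corollary3p2 (R : realType) (alpha : R)
    (alpha_gt0 : 0 < alpha) (alpha_lt1 : alpha < 1) (s : R) (s_gt0 : 0 < s) :
  exists2 c : R, 0 < c &
    forall (d : measure_display) (T : measurableType d) (P : probability T R)
           (U : {RV P >-> R}),
      has_law U (uniform_prob (pi_gt0 R)) ->
      mixture_of_exponentials
        (powRV (V_RV alpha U) s \- cst c : {RV P >-> R}).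
Proof.
have [beta alphaE] : exists beta, 1 - alpha = beta by exists (1 - alpha).
have beta01 : 0 < beta < 1 by rewrite -alphaE; lra.
have beta0 : 0 < beta by case/andP: beta01.
pose t0 := critical_value beta.
have t0_gt0 : 0 < t0 := critical_value_gt0 beta01.
have kappa0 : 0 < beta / s by rewrite divr_gt0.
have c0 : 0 < t0 `^ (s / beta) by exact: powR_gt0.
exists (t0 `^ (s / beta)) => // d T P U lawU.
set c := t0 `^ (s / beta) in c0 *.
have cE : c `^ (- (beta / s)) = t0^-1.
  rewrite /c -powRrM mulrN -[s / beta]invf_div mulVf ?gt_eqF// powR_inv1 ?ltW//.
apply: (@mixture_of_exponentials_tails _ _ _ _ _ (weight beta)
  (fun n => n.+1%:R * (beta / s)) c) => //.
- exact: weight_ge0.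
- by move=> n; rewrite mulr_gt0.
- exact: weight_sum1 alphaE beta01.
move=> x x0.
pose f (u : R) := (b_fun alpha u `^ (- beta^-1)) `^ s - c.
have mf : measurable_fun setT f.
  apply: measurable_funB => //.
  apply: (measurableT_comp (measurable_powR s)).
  apply: (measurableT_comp (measurable_powR (- beta^-1))).
  exact: measurable_b_fun.
pose A := f @^-1` `]x, +oo[%classic.
have mA : measurable A by rewrite -[A]setTI; exact: mf.
apply: (@etrans _ _ (distribution P U A)); first by rewrite /A /f -alphaE.
apply: (etrans (lawU A mA)).
have cx0 : 0 < c + x by rewrite ltr_wpDr.
have cx1 : 0 < 1 + x / c by rewrite ltr_wpDr// divr_ge0// ltW.
(* The threshold for [b_fun]: [V^s - c > x] means [b_fun alpha u < y]. *)
pose y := t0^-1 * (1 + x / c) `^ (- (beta / s)).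
have yE : y = (c + x) `^ (- (beta / s)).
  rewrite /y -cE -powRM ?ltW//; congr (_ `^ _).
  by rewrite mulrDr mulr1 mulrCA divff ?mulr1// gt_eqF.
have y0 : 0 < y by rewrite yE powR_gt0.
have fE u : 0 < u < pi -> (x < f u) = (b_fun alpha u < y).
  move=> /(angle_b_fun alphaE beta01)[/andP[b0 _] _].
  rewrite /f ltrBrDl yE; set b := b_fun alpha u in b0 *.
  have -> : (b `^ (- beta^-1)) `^ s = b `^ (- (s / beta)).
    by rewrite -powRrM; congr (_ `^ _); ring.
  have ltr_lnE (p q : R) : 0 < p -> 0 < q -> (p < q) = (ln p < ln q).
    by move=> p0 q0; rewrite ltr_ln.
  rewrite (ltr_lnE (c + x)) ?powR_gt0// (ltr_lnE b) ?powR_gt0// !ln_powR.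
  by rewrite !mulNr ltrNr -ltr_pdivlMl ?divr_gt0// invf_div mulrN.
have A0 u : 0 < u < pi -> A u <-> b_fun alpha u < y.
  by move=> /fE <-; rewrite /A/= in_itv/= andbT.
have wE n : weight beta n * (1 + x / c) `^ (- (n.+1%:R * (beta / s))) =
    angle_coef beta n.+1 * y ^+ n.+1 / pi.
  rewrite mulrC -mulrN powRrM powRAC powR_mulrn ?powR_ge0// /weight /y exprMn.
  by ring.
under eq_eseriesr do rewrite wE.
(* At [x = 0] the threshold is the boundary value [t0^-1], out of reach of [angle_eseries]; the
   event is then almost sure, and [weight_sum1] gives its probability. *)
have [x_gt0|] := ltP 0 x; last first.
  move=> x_le0; have xE : x = 0 by apply/eqP; rewrite eq_le x_le0.
  have yt : y = t0^-1 by rewrite /y xE mul0r addr0 powR1 mulr1.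
  rewrite (uniform_prob_tail mA (a := 0)) ?lexx ?pi_gt0//.
    rewrite subr0 divff ?gt_eqF ?pi_gt0// -(weight_sum1 alphaE beta01).
    by apply: eq_eseriesr => n _; rewrite yt.
  apply/seteqP; split => u /=; first by case.
  rewrite in_itv/= => u0; split => //; apply/(A0 _ u0); rewrite yt.
  by have [/andP[]] := angle_b_fun alphaE beta01 u0.
have yt : y < t0^-1.
  rewrite /y -[ltRHS]mulr1 ltr_pM2l ?invr_gt0// powRN invf_lt1 ?powR_gt0//.
  rewrite [ltLHS](_ : _ = 1 `^ (beta / s)); last by rewrite powR1.
  by rewrite gt0_ltr_powR ?nnegrE ?(ltW cx1)// ltrDl divr_gt0.
have y01 : 0 <= y < t0^-1 by rewrite ltW.
have api : angle beta y < pi by exact: angle_lt_pi.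
have a_gt0 : 0 < angle beta y by rewrite -(angle0 beta) angle_lt.
rewrite angle_eseries// (uniform_prob_tail mA (a := pi - angle beta y)).
- by rewrite subKr.
- by rewrite subr_ge0 ltW//= ltrBlDr ltrDl.
(* By strict monotonicity of [angle], [b_fun alpha u < y] amounts to [pi - u < angle beta y]. *)
apply/seteqP; split => u /=; rewrite !in_itv/=.
  case=> Au u0; have [/andP[b0 bt] bu] := angle_b_fun alphaE beta01 u0.
  have /andP[_ ->] := u0; rewrite andbT ltrBlDl -ltrBlDr -bu.
  have b_lt_y := (A0 _ u0).1 Au.
  exact: (angle_lt beta01 (ltW b0) b_lt_y yt).
move=> /andP[au upi].
have u0 : 0 < u < pi by rewrite upi (lt_trans _ au)// subr_gt0.
have [/andP[b0 bt] bu] := angle_b_fun alphaE beta01 u0.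
split => //; apply/(A0 _ u0); rewrite ltNge; apply/negP.
rewrite le_eqVlt => /predU1P[yb|yb]; first by move: au; rewrite yb bu subKr ltxx.
have := angle_lt beta01 (ltW y0) yb bt; rewrite bu => h.
by move: au; rewrite ltrBlDl -ltrBlDr ltNge (ltW h).
Qed.
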